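(* Let $\phi^t$ be a contact Anosov flow on a closed oriented $3$-manifold, defined by a bi-contact structure $(\xi_-,\xi_+)$ and preserving a contact structure $\eta_+$ (positive). Then the flow $\psi^t$ defined by the bi-contact structure $(\xi_-,\eta_+)$ is Anosov.
   Context: A bi-contact structure on an oriented $3$-manifold is a pair of transverse contact structures, the first negative and the second positive, given as kernels of $C^1$ $1$-forms. A non-vanishing vector field spanning the intersection of the two plane fields, and its flow, are said to be defined by the bi-contact structure (they are determined up to reparametrization). A contact Anosov flow is an Anosov flow whose generating vector field is the Reeb vector field of a contact form $\beta_+$; the preserved contact structure is $\eta_+=\ker\beta_+$. *)

(* Defs.v *)
From mathcomp Require Import all_boot all_order all_algebra.
From mathcomp Require Import all_classical all_reals all_analysis.
Set Implicit Arguments.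
Unset Strict Implicit.
Unset Printing Implicit Defensive.
Import Order.TTheory GRing.Theory Num.Theory.
Import numFieldNormedType.Exports.
Local Open Scope classical_set_scope.
Local Open Scope ring_scope.

(* The differential is taken as a function of the point for each fixed vector;
   in finite dimension this is the usual notion of a C^k map. Only meaningful
   for open U. *)
Fixpoint Ck (R : realType) (V W : normedModType R) (k : nat) (U : set V)
    (f : V -> W) : Prop :=
  if k is k'.+1 then
    (forall x, U x -> differentiable f x) /\
    (forall v, Ck k' U (fun x => 'd f x v))
  else forall x, U x -> {for x, continuous f}.

Definition smooth (R : realType) (V W : normedModType R) (U : set V)
  (f : V -> W) : Prop := forall k, Ck k U f.

(* Charts are homeomorphisms between an open set [dom i] of the manifold and an
   open set [cod i] of R^3, so there is no boundary. The values of [coord i] and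
   [param i] outside these sets are irrelevant. Second countability follows from
   compactness; connectedness is not required. *)
Record closed_oriented_3manifold (R : realType) := Closed3Manifold {
  carrier :> topologicalType;
  chart : Type;
  dom : chart -> set carrier;
  cod : chart -> set 'rV[R]_3;
  coord : chart -> carrier -> 'rV[R]_3;
  param : chart -> 'rV[R]_3 -> carrier;
  closed3_compact : compact [set: carrier];
  closed3_hausdorff : hausdorff_space carrier;
  open_dom : forall i, open (dom i);
  open_cod : forall i, open (cod i);
  dom_cover : forall p, exists i, dom i p;
  coord_cod : forall i p, dom i p -> cod i (coord i p);
  param_dom : forall i x, cod i x -> dom i (param i x);
  coordK : forall i p, dom i p -> param i (coord i p) = p;
  paramK : forall i x, cod i x -> coord i (param i x) = x;
  continuous_coord : forall i p, dom i p -> {for p, continuous (coord i)};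
  continuous_param : forall i x, cod i x -> {for x, continuous (param i)};
  transition_smooth : forall i j,
    smooth [set x | cod i x /\ dom j (param i x)] (coord j \o param i);
  transition_oriented : forall i j x, cod i x -> dom j (param i x) ->
    0 < \det (jacobian (coord j \o param i) x)
}.

Section Tensors.
Context (R : realType) (M : closed_oriented_3manifold R).

Definition overlap (i j : chart M) : set 'rV[R]_3 :=
  [set x | cod i x /\ dom j (param i x)].

Definition transition (i j : chart M) : 'rV[R]_3 -> 'rV[R]_3 :=
  coord j \o param i.

(* Tensor fields are families of local representatives, one for each chart,
   related by the differentials of the transition maps. A representative in the
   chart i is only relevant on [cod i]. *)
Definition field := chart M -> 'rV[R]_3 -> 'rV[R]_3.
Definition cofield := chart M -> 'rV[R]_3 -> 'cV[R]_3.
Definition subspace_field := chart M -> 'rV[R]_3 -> set 'rV[R]_3.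
Definition bilinear_field := chart M -> 'rV[R]_3 -> 'M[R]_3.

Definition vector_field (k : nat) (X : field) : Prop :=
  (forall i j x, overlap i j x ->
     X j (transition i j x) = 'd (transition i j) x (X i x)) /\
  (forall i, Ck k (cod i) (X i)).

Definition ap (a : 'cV[R]_3) (v : 'rV[R]_3) : R := (v *m a) 0 0.

Definition one_form (k : nat) (a : cofield) : Prop :=
  (forall i j x v, overlap i j x ->
     ap (a j (transition i j x)) ('d (transition i j) x v) = ap (a i x) v) /\
  (forall i, Ck k (cod i) (a i)).

(* d a (u, v) = u (a v) - v (a u) for constant vector fields u, v *)
Definition ext_d (a : cofield) (i : chart M) (x u v : 'rV[R]_3) : R :=
  ap ('d (a i) x u) v - ap ('d (a i) x v) u.

(* the coefficient of a /\ da with respect to dx0 /\ dx1 /\ dx2 *)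
Definition contact_volume (a : cofield) (i : chart M) (x : 'rV[R]_3) : R :=
  let e (k : 'I_3) : 'rV[R]_3 := delta_mx 0 k in
  let e0 := e 0 in let e1 := e 1 in let e2 := e 2%:R in
  ap (a i x) e0 * ext_d a i x e1 e2 +
  ap (a i x) e1 * ext_d a i x e2 e0 +
  ap (a i x) e2 * ext_d a i x e0 e1.

Definition positive_contact_form (a : cofield) : Prop :=
  one_form 1 a /\ forall i x, cod i x -> 0 < contact_volume a i x.

Definition negative_contact_form (a : cofield) : Prop :=
  one_form 1 a /\ forall i x, cod i x -> contact_volume a i x < 0.

Definition is_kernel (xi : subspace_field) (a : cofield) : Prop :=
  forall i x, cod i x -> xi i x = [set v | ap (a i x) v = 0].

Definition positive_contact (xi : subspace_field) : Prop :=
  exists2 a, positive_contact_form a & is_kernel xi a.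

Definition negative_contact (xi : subspace_field) : Prop :=
  exists2 a, negative_contact_form a & is_kernel xi a.

Definition transverse (xi eta : subspace_field) : Prop :=
  forall i x, cod i x -> forall v,
    exists u w, [/\ xi i x u, eta i x w & v = u + w].

Definition bi_contact (xi_m xi_p : subspace_field) : Prop :=
  [/\ negative_contact xi_m, positive_contact xi_p & transverse xi_m xi_p].

Definition line (v : 'rV[R]_3) : set 'rV[R]_3 := range (fun c : R => c *: v).

Definition spans_intersection (X : field) (xi eta : subspace_field) : Prop :=
  forall i x, cod i x -> X i x != 0 /\ xi i x `&` eta i x = line (X i x).

Definition reeb_field (X : field) (b : cofield) : Prop :=
  forall i x, cod i x ->
    ap (b i x) (X i x) = 1 /\ forall v, ext_d b i x (X i x) v = 0.

End Tensors.

Section Flows.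
Context (R : realType) (M : closed_oriented_3manifold R).

(* the time-t map read in the chart i at the source and j at the target *)
Definition local_flow (phi : R -> M -> M) (i j : chart M) (t : R)
  (x : 'rV[R]_3) : 'rV[R]_3 := coord j (phi t (param i x)).

Definition flow_overlap (phi : R -> M -> M) (i j : chart M) (t : R) :
  set 'rV[R]_3 := [set x | cod i x /\ dom j (phi t (param i x))].

(* phi is the flow of X. The flow of a C^1 vector field on a closed manifold
   is always a C^1 map R x M -> M, so the last two clauses are no restriction. *)
Definition flow_of (X : field M) (phi : R -> M -> M) : Prop :=
  [/\ forall p, phi 0 p = p,
      forall s t p, phi (s + t) p = phi s (phi t p),
      forall t p j, dom j (phi t p) ->
        is_derive t 1 (fun s : R => coord j (phi s p))
          (X j (coord j (phi t p))),
      continuous (fun z : R * M => phi z.1 z.2) &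
      forall i j,
        Ck 1 [set z : R * 'rV[R]_3 | flow_overlap phi i j z.1 z.2]
             (fun z : R * 'rV[R]_3 => local_flow phi i j z.1 z.2)].

Definition riemannian_metric (g : bilinear_field M) : Prop :=
  [/\ forall i j x (u v : 'rV[R]_3), overlap i j x ->
        'd (transition i j) x u *m g j (transition i j x)
          *m ('d (transition i j) x v)^T = u *m g i x *m v^T,
      forall i, smooth (cod i) (g i),
      forall i x, cod i x -> (g i x)^T = g i x &
      forall i x (v : 'rV[R]_3), cod i x -> v != 0 ->
        0 < (v *m g i x *m v^T) 0 0].

Definition metric_norm (g : bilinear_field M) (i : chart M) (x v : 'rV[R]_3) :
  R := Num.sqrt ((v *m g i x *m v^T) 0 0).

(* continuous line subbundles of TM *)
Definition line_field (E : subspace_field M) : Prop :=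
  (forall i j x, overlap i j x ->
     E j (transition i j x) = 'd (transition i j) x @` E i x) /\
  (forall i x, cod i x -> exists s : 'rV[R]_3 -> 'rV[R]_3,
     \forall y \near x,
       [/\ {for y, continuous s}, s y != 0 & E i y = line (s y)]).

Definition flow_invariant (phi : R -> M -> M) (E : subspace_field M) : Prop :=
  forall t i j x, flow_overlap phi i j t x ->
    E j (local_flow phi i j t x) = 'd (local_flow phi i j t) x @` E i x.

(* |D phi^(sg * t) v| <= A exp(- B t) |v| for v in E and t >= 0 *)
Definition contracted (phi : R -> M -> M) (g : bilinear_field M)
    (E : subspace_field M) (sg A B : R) : Prop :=
  forall t i j x v, 0 <= t -> flow_overlap phi i j (sg * t) x -> E i x v ->
    metric_norm g j (local_flow phi i j (sg * t) x)
      ('d (local_flow phi i j (sg * t)) x v)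
    <= A * expR (- (B * t)) * metric_norm g i x v.

(* In the splitting TM = <X> + Es + Eu the three summands are lines, so that
   spanning the tangent spaces, of dimension 3, makes the sum direct. *)
Definition anosov (X : field M) (phi : R -> M -> M) : Prop :=
  exists (g : bilinear_field M) (Es Eu : subspace_field M) (A B : R),
  [/\ [/\ riemannian_metric g, line_field Es, line_field Eu, 0 < A & 0 < B],
      forall i x, cod i x -> forall v, exists c s u,
        [/\ Es i x s, Eu i x u & v = c *: X i x + s + u],
      flow_invariant phi Es, flow_invariant phi Eu &
      contracted phi g Es 1 A B /\ contracted phi g Eu (- 1) A B].

(* phi is an Anosov flow whose generating vector field X is the Reeb field of a
   (positive) contact form with kernel eta *)
Definition contact_anosov (X : field M) (phi : R -> M -> M)
    (eta : subspace_field M) : Prop :=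
  anosov X phi /\
  exists b, [/\ positive_contact_form b, is_kernel eta b & reeb_field X b].

End Flows.

(* Main.v *)
Require Import Defs.
From mathcomp Require Import all_boot all_order all_algebra.
From mathcomp Require Import all_classical all_reals all_analysis.
From mathcomp Require Import ring lra.
(** Let [al], [be], [b] be the forms with kernels [xi_m], [xi_p], [eta_p], and X
    the Reeb field of [b]. Since X spans the intersection of [xi_m] and [xi_p],
    [(al, b, be)] is a coframe: a vector killed by [al] and [be] is a multiple of
    X, and [b X = 1]. It trivialises the tangent bundle, so the differential of
    the flow of Y becomes a cocycle of 3 x 3 matrices over the manifold.

    Along the flow of Y, write [w, u] for the values of [al], [b] on a transported
    vector. As [Y] is in both kernels, [u' = db(Y, .)] and [w' = dal(Y, .)]; the
    Reeb condition [db(X, .) = 0] removes the [u]-term of the first equation: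
    [u' = f w], [w' = g u + h w]. The opposite signs of the two contact volumes
    say exactly that [f g > 0]. Up to the sign of [w], a narrow cone
    [- K u <= w <= - d u] is then invariant in backward time, and in it
    [u' <= - c d u]. A third inequality on the coordinate along Y makes it a cone
    of the whole tangent space, not only of the quotient by Y. The vectors whose
    forward orbit stays in the cone form the strong stable line: existence by
    compactness, uniqueness because [u, w >= 0] is forward invariant with
    [u' >= 0], continuity because the graph is closed. Reversing time gives the
    unstable line. The Riemannian metric is the one of the given Anosov flow. *)
Set Implicit Arguments.
Unset Strict Implicit.
Unset Printing Implicit Defensive.
Import Order.TTheory GRing.Theory Num.Theory.
Import numFieldNormedType.Exports.
Local Open Scope classical_set_scope.
Local Open Scope ring_scope.

(** * Differential inequalities *)

Lemma is_derive_cts (R : realType) (f : R -> R) (t d : R) :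
  is_derive t 1 f d -> {for t, continuous f}.
Proof. by move=> [df _]; apply/differentiable_continuous/derivable1_diffP. Qed.

Lemma is_derive_gt0_right (R : realType) (f : R -> R) (t d : R) :
  is_derive t 1 f d -> 0 < d -> \forall s \near t^'+, f t < f s.
Proof.
move=> [fd fdE] d0.
have dcv : (h^-1 *: (f (h *: 1 + t) - f t)) @[h --> 0^'] --> d.
  by rewrite -fdE; exact: fd.
have : \forall h \near 0^', 0 < h^-1 *: (f (h *: 1 + t) - f t).
  exact: cvgr_gt _ dcv _ d0.
rewrite near_withinE nearE => /nbhs_ballP[e /= e0 He].
exists e => //= s; rewrite /ball/= => ts tlts.
have := He (s - t); rewrite /ball/= sub0r normrN distrC => /(_ ts).
have st0 : 0 < s - t by rewrite subr_gt0.
move=> /(_ (lt0r_neq0 st0)).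
rewrite [_%:A]mulr1 subrK /GRing.scale/= pmulr_rgt0 ?invr_gt0//.
by rewrite subr_gt0.
Qed.

(* At the infimum of the violation times every function is still nonnegative,
   and each of them stays so a little longer: by continuity if it is positive,
   by the sign of its derivative if it vanishes. *)
Lemma barrier (R : realType) (I : finType) (F dF : I -> R -> R) :
  (forall k (t : R), 0 <= t -> is_derive t 1 (F k) (dF k t)) ->
  (forall k, 0 <= F k 0) ->
  (forall k (t : R), 0 <= t -> (forall j, 0 <= F j t) -> F k t = 0 -> 0 < dF k t) ->
  forall k (t : R), 0 <= t -> 0 <= F k t.
Proof.
move=> Fd F0 Fb k0 t0 t00; rewrite leNgt; apply/negP => Fneg.
pose B := [set s : R | 0 <= s /\ exists k, F k s < 0].
have Bt0 : B t0 by split => //; exists k0.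
have hB : has_inf B by split; [exists t0|exists 0 => s []].
pose T := inf B.
have T0 : 0 <= T by apply: lb_le_inf => [|s []//]; exists t0.
have before s k : 0 <= s -> s < T -> 0 <= F k s.
  move=> s0 sT; rewrite leNgt; apply/negP => Fs.
  by have := ge_inf hB.2 (conj s0 (ex_intro _ k Fs)); rewrite leNgt sT.
have atT k : 0 <= F k T.
  rewrite leNgt; apply/negP => FT.
  have [T00|Tn0] := eqVneq T 0; first by move: FT; rewrite T00 ltNge F0.
  have Tgt0 : 0 < T by rewrite lt_neqAle eq_sym Tn0.
  have : \forall s \near T, F k s < 0.
    exact: cvgr_lt _ (is_derive_cts (Fd k T T0)) _ FT.
  move=> /nbhs_ballP[e /= e0 He].
  (* A time just before [T]; the maximum with 0 keeps it in the range where nothing is violated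
     yet. *)
  pose s := Num.max 0 (T - e / 2).
  have sT : s < T by rewrite /s gt_max Tgt0 ltrBlDr ltrDl divr_gt0.
  have s0 : 0 <= s by rewrite /s le_max lexx.
  have : F k s < 0.
    apply: He; rewrite /ball/= gtr0_norm ?subr_gt0// ltrBlDr -ltrBlDl.
    by rewrite /s lt_max; apply/orP; right; rewrite ltrD2l ltrN2; lra.
  by rewrite ltNge before.
have after k : \forall s \near T^'+, 0 <= F k s.
  have := atT k; rewrite le_eqVlt => /orP[/eqP/esym FT|FT].
    have := is_derive_gt0_right (Fd k T T0) (Fb k T T0 atT FT).
    by apply: filterS => s; rewrite FT => /ltW.
  have H : \forall s \near T, 0 < F k s.
    exact: cvgr_gt _ (is_derive_cts (Fd k T T0)) _ FT.
  by apply: cvg_within; apply: filterS H => s /ltW.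
(* Finiteness of [I] gives one interval to the right of [T] that is valid for all [k]. *)
have [e /= e0 He] : \forall s \near T^'+, forall k, 0 <= F k s.
  exact: filter_forall.
have [b [b0 [k Fbneg]] bT] := inf_adherent e0 hB.
have Tb : T <= b by apply: ge_inf; [exact: hB.2|split => //; exists k].
move: Fbneg; rewrite ltNge; have := Tb; rewrite le_eqVlt => /orP[/eqP <-|Tltb].
  by rewrite atT.
rewrite He// /ball/= ltr0_norm ?subr_lt0//; rewrite -/T in bT; lra.
Qed.

(** * Stable directions of a linear cocycle *)

Lemma sum3E (V : nmodType) (F : 'I_3 -> V) :
  \sum_i F i = F 0 + F 1 + F 2%:R.
Proof.
rewrite !big_ord_recl big_ord0 addr0 addrA.
by congr (_ + _ + _); congr F; apply: val_inj.
Qed.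

Lemma ord3P (P : 'I_3 -> Prop) : P 0 -> P 1 -> P 2%:R -> forall i, P i.
Proof.
move=> P0 P1 P2 [[|[|[|//]]] i3].
- by rewrite (_ : Ordinal i3 = 0)//; apply: val_inj.
- by rewrite (_ : Ordinal i3 = 1)//; apply: val_inj.
- by rewrite (_ : Ordinal i3 = 2%:R)//; apply: val_inj.
Qed.

Lemma row3P (T : nmodType) (v w : 'rV[T]_3) : v 0 0 = w 0 0 -> v 0 1 = w 0 1 ->
  v 0 2%:R = w 0 2%:R -> v = w.
Proof. by move=> e0 e1 e2; apply/rowP; apply: ord3P. Qed.

Lemma mulmx3E (T : pzRingType) m n (v : 'M[T]_(m, 3)) (A : 'M[T]_(3, n)) i j :
  (v *m A) i j = v i 0 * A 0 j + v i 1 * A 1 j + v i 2%:R * A 2%:R j.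
Proof. by rewrite mxE sum3E. Qed.

Lemma is_derive_translate (R : realType) (f : R -> R) (t d : R) :
  is_derive (0 : R) 1 (fun h : R => f (h + t)) d -> is_derive t 1 f d.
Proof.
have E : (fun h : R => h^-1 *: ((f \o shift t) (h *: 1) - f t)) =
   (fun h => h^-1 *: (((fun h => f (h + t)) \o shift 0) (h *: 1) - f (0 + t))).
  by apply/funext => h /=; rewrite addr0 add0r.
move=> [df dfE]; split; first by rewrite /derivable E.
by rewrite -dfE /derive E.
Qed.

Section Cocycle.
Variables (R : realType) (M : topologicalType) (psi : R -> M -> M) (A : R -> M -> 'M[R]_3).
Variable a : M -> 'M[R]_3.
Hypotheses (psi0 : forall p, psi 0 p = p)
  (psiD : forall s t p, psi (s + t) p = psi s (psi t p)).
Hypotheses (A0 : forall p, A 0 p = 1%:M)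
  (AD : forall s t p, A (s + t) p = A t p *m A s (psi t p)).
Hypothesis Ader : forall p i j, is_derive (0 : R) 1 (fun t : R => A t p i j) (a p i j).

Lemma cocycleK t p : A t p *m A (- t) (psi t p) = 1%:M.
Proof. by rewrite -AD addNr A0. Qed.

Lemma cocycle_eq0 (V : 'rV[R]_3) t p : V *m A t p = 0 -> V = 0.
Proof. by move=> VA; rewrite -[V]mulmx1 -(cocycleK t p) mulmxA VA mul0mx. Qed.

(** The cocycle identity moves the base point to [psi t p], so that the derivative at time 0
    suffices. *)
Lemma cocycle_derive (V : 'rV[R]_3) p (t : R) j :
  is_derive t 1 (fun t : R => (V *m A t p) 0 j) ((V *m A t p *m a (psi t p)) 0 j).
Proof.
apply: is_derive_translate.
set W := V *m A t p.
have -> : (fun h => (V *m A (h + t) p) 0 j) =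
   \sum_(i < 3) (fun h => W 0 i * A h (psi t p) i j).
  by apply/funext => h; rewrite AD mulmxA fct_sumE mxE.
rewrite mxE; apply: is_derive_sum.
Qed.

Lemma cocycle_derive_rev (V : 'rV[R]_3) p (t : R) j :
  is_derive t 1 (fun t : R => (V *m A (- t) p) 0 j)
    (- (V *m A (- t) p *m a (psi (- t) p)) 0 j).
Proof.
have H := cocycle_derive V p (- t) j.
have N : is_derive t 1 (-%R : R -> R) (- 1) by exact: is_deriveNid.
have := @is_derive1_comp _ _ (-%R : R -> R) t _ _ H N.
by rewrite mulrN1.
Qed.

(** [c] bounds from below the two entries that couple [w] and [u], [C] bounds all entries. [d] and
    [K] are the slopes of the cone, [L] its aperture along the flow. [Hd], [HK] and [HL] make
    reversed time point inwards on the face of slope [d], on that of slope [K], and on the two faces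
    where [s] is [L u] or [- L u]. *)
Variables c C d K L : R.
Hypotheses (c0 : 0 < c) (d0 : 0 < d) (dK : d < K) (L0 : 0 < L).
Hypotheses (Hd : C * d + C * d * d < c) (HK : C + C * K < K * K * c)
  (HL : C * (1 + K) < L * c * d).
Hypotheses (a01 : forall p, c <= a p 0 1) (a10 : forall p, c <= a p 1 0)
  (aC : forall p i j, `|a p i j| <= C).
Hypotheses (a11 : forall p, a p 1 1 = 0) (a2 : forall p j, a p 2%:R j = 0).
Hypothesis A2 : forall t p, [/\ A t p 2%:R 0 = 0, A t p 2%:R 1 = 0 & A t p 2%:R 2%:R = 1].

(* Row vectors are (w, u, s), with s the coordinate along the flow. *)
Let lin (k : bool * bool) (V : 'rV[R]_3) : R :=
  match k with
  | (false, false) => - V 0 0 - d * V 0 1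
  | (false, true) => K * V 0 1 + V 0 0
  | (true, false) => L * V 0 1 - V 0 2%:R
  | (true, true) => L * V 0 1 + V 0 2%:R
  end.

Definition cone (V : 'rV[R]_3) := forall k, 0 <= lin k V.

Lemma coneP V : cone V ->
  [/\ 0 <= V 0 1, V 0 0 <= - (d * V 0 1), - (K * V 0 1) <= V 0 0,
      V 0 2%:R <= L * V 0 1 & - (L * V 0 1) <= V 0 2%:R].
Proof.
move=> CV.
have /= h1 := CV (false, false); have /= h2 := CV (false, true).
have /= h3 := CV (true, false); have /= h4 := CV (true, true).
have Kd : 0 < K - d by rewrite subr_gt0.
by split; [rewrite -(pmulr_rge0 _ Kd)|..]; lra.
Qed.

Lemma cone_gt0 V : cone V -> V != 0 -> 0 < V 0 1.
Proof.
move=> /coneP[u0 w1 w2 s1 s2] V0; rewrite lt_neqAle u0 andbT.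
apply: contra V0 => /eqP/esym u00; move: w1 w2 s1 s2.
rewrite u00 !mulr0 oppr0 => w1 w2 s1 s2; apply/eqP/row3P; rewrite mxE; lra.
Qed.

(** [barrier] applies to the four functionals [lin k] along the reversed orbit: at a nonzero vector
    on a face of the cone, the reversed derivative of the vanishing functional is positive. *)
Lemma cone_rev V p t : cone V -> V != 0 -> 0 <= t -> cone (V *m A (- t) p).
Proof.
move=> CV V0 t0 k.
pose W (s : R) := V *m A (- s) p.
apply: (@barrier R _ (fun k s => lin k (W s))
  (fun k s => lin k (- (W s *m a (psi (- s) p)))) _ _ _ k t t0).
- move=> {}k s _.
  have H j : is_derive s 1 (fun s : R => W s 0 j)
      ((- (W s *m a (psi (- s) p))) 0 j).
    by rewrite mxE; exact: cocycle_derive_rev.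
  case: k => [[] []] /=.
  + exact: (is_deriveD (is_deriveZ L (H 1)) (H 2%:R)).
  + exact: (is_deriveB (is_deriveZ L (H 1)) (H 2%:R)).
  + exact: (is_deriveD (is_deriveZ K (H 1)) (H 0)).
  + exact: (is_deriveB (is_deriveN (H 0)) (is_deriveZ d (H 1))).
- by move=> {}k; rewrite /W oppr0 A0 mulmx1; exact: CV.
- move=> {}k s s0 CW Wk.
  have Wn0 : W s != 0 by apply: contra V0 => /eqP/cocycle_eq0/eqP.
  move: (psi _ _) (W s) CW Wk Wn0 => q X CX Xk Xn0.
  have u0 := cone_gt0 CX Xn0.
  have [_ w1 w2 s1 s2] := coneP CX.
  have f1 := a01 q; have g1 := a10 q.
  have := aC q 0 1; rewrite ler_norml => /andP[_ f2].
  have C0 : 0 < C. exact: lt_le_trans c0 (le_trans f1 f2).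
  have K0 : 0 < K by exact: lt_trans dK.
  (* In the cone [x = - w] lies between [d u] and [K u], so every term below is compared with a
     multiple of [u]. *)
  have [x Ex] : exists x, X 0 0 = - x by exists (- X 0 0); rewrite opprK.
  move: u0 w1 w2 s1 s2; set u := X 0 1; rewrite Ex => u0 w1 w2 s1 s2.
  have x0 : 0 <= x by have := mulr_ge0 (ltW d0) (ltW u0); lra.
  have cf : d * u * c <= x * a q 0 1.
    by apply: ler_pM => //; [by apply: mulr_ge0; exact: ltW|exact: ltW|lra].
  have Cx (y : R) : `|y| <= C -> `|x * y| <= C * K * u.
    move=> yC; rewrite normrM (ger0_norm x0) mulrC -mulrA.
    by apply: ler_pM => //; lra.
  have Cu (y : R) : `|y| <= C -> `|u * y| <= C * u.
    by move=> yC; rewrite normrM (gtr0_norm u0) mulrC ler_wpM2r// ltW.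
  have := Cx _ (aC q 0 0); have := Cx _ (aC q 0 2%:R); have := Cu _ (aC q 1 2%:R).
  rewrite !ler_norml => /andP[m1 m2] /andP[l1 l2] /andP[h1 h2].
  have := Cu _ (aC q 1 0); rewrite ler_norml => /andP[_ g2].
  have gu : c * u <= u * a q 1 0 by rewrite mulrC ler_pM2l.
  have HLu : C * (1 + K) * u < L * c * d * u by rewrite ltr_pM2r.
  have cfL : L * (d * u * c) <= L * (x * a q 0 1) by rewrite ler_pM2l.
  have HKu : (C + C * K) * u < K * K * c * u by rewrite ltr_pM2r.
  have Hdu : (C * d + C * d * d) * u < c * u by rewrite ltr_pM2r.
  have NE (Y : 'rV[R]_3) j : (- Y) 0 j = - Y 0 j by rewrite mxE.
  (* The faces come in the order [L u + s], [L u - s], [K u + w], [- w - d u]; on the last two, [x]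
     is [K u] and [d u]. *)
  case: k Xk => [[] []] /=; rewrite !NE !mulmx3E !a11 !a2 -/u Ex => Xk.
  + lra.
  + lra.
  + have xK : x = K * u by lra.
    rewrite xK in h1 h2 *.
    have : K * (K * u * c) <= K * (K * u * a q 0 1).
      by rewrite ler_pM2l// ler_pM2l// mulr_gt0.
    lra.
  + have xd : x = d * u by lra.
    have xh : x * a q 0 0 <= x * C.
      by rewrite ler_wpM2l// (le_trans _ (aC q 0 0))// ler_norm.
    have xf : d * (x * a q 0 1) <= d * (x * C) by rewrite ler_pM2l// ler_wpM2l.
    rewrite xd in xh xf *; lra.
Qed.

Definition cone_orbit p (V : 'rV[R]_3) := forall s, 0 <= s -> cone (V *m A s p).

(** In the cone [w <= - d u], hence [u' <= - c d u], and the product of [u] with the exponential of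
    [c d t] does not increase. *)
Lemma cone_orbit_decay p V t : cone_orbit p V -> 0 <= t ->
  (V *m A t p) 0 1 <= expR (- (c * d * t)) * V 0 1.
Proof.
move=> gV t0.
pose g (s : R) := expR (c * d * s) * (V *m A s p) 0 1.
pose dg (s : R) := expR (c * d * s) *
  (c * d * (V *m A s p) 0 1 + (V *m A s p *m a (psi s p)) 0 1).
have gd (s : R) : is_derive s 1 g (dg s).
  have H1 : is_derive s 1 (fun s => c * d * s) (c * d).
    have := is_deriveZ (c * d) (is_derive_id s (1 : R)).
    by rewrite [_%:A]mulr1.
  have H2 := is_derive1_comp (is_derive_expR (c * d * s)) H1.
  have H3 := is_deriveM H2 (cocycle_derive V p s 1).
  refine (@is_derive_eq _ _ _ g s 1 _ _ H3 _).
  by rewrite /dg /GRing.scale /=; ring.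
have : g t <= g 0.
  apply: (@ler0_derive1_nincry _ _ 0) => //.
  - move=> s; rewrite in_itv/= andbT => s0.
    rewrite derive1E (@derive_val _ _ _ _ _ _ _ (gd s)) /dg.
    rewrite pmulr_rle0 ?expR_gt0//.
    have := gV _ (ltW s0); move: (V *m _) => X /coneP[u0 w1 _ _ _].
    rewrite mulmx3E a11 a2 !mulr0 !addr0.
    have w0 : X 0 0 <= 0 by rewrite (le_trans w1)// oppr_le0 mulr_ge0// ltW.
    have := ler_wnM2l w0 (a01 (psi s p)); have := ler_wpM2l (ltW c0) w1; lra.
  - apply: continuous_subspaceT => s; exact: is_derive_cts (gd s).
rewrite /g mulr0 expR0 mul1r A0 mulmx1 expRN => gt.
by rewrite mulrC ler_pdivlMr ?expR_gt0// mulrC.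
Qed.

Lemma expR_small (x : R) : 0 < x -> exists2 t, 0 <= t & expR (- t) < x.
Proof.
move=> x0; exists x^-1; first by rewrite invr_ge0 ltW.
rewrite expRN -[ltRHS]invrK ltf_pV2 ?posrE ?expR_gt0 ?invr_gt0//.
by rewrite (lt_le_trans _ (expR_ge1Dx _))// ltrDr.
Qed.

(** By [A2] the cocycle fixes the flow direction [(0, 0, 1)]. *)
Lemma cocycle_fixed t p (V : 'rV[R]_3) :
  V 0 0 = 0 -> V 0 1 = 0 -> V *m A t p = V.
Proof.
move=> V0 V1; have [h0 h1 h2] := A2 t p.
by apply: row3P; rewrite mulmx3E V0 V1 ?h0 ?h1 ?h2 !mul0r ?mulr0 ?mulr1 !add0r.
Qed.

(** If [w] were larger for [V], the difference would start in the quadrant [w, u >= 0], which is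
    forward invariant and where [u] does not decrease. Its [u] would then stay above a positive
    constant, although the [u] of both vectors tends to 0. *)
Lemma cone_orbit_le p V V' : cone_orbit p V -> cone_orbit p V' -> V 0 1 = 1 ->
  V' 0 1 = 1 ->
  V 0 0 <= V' 0 0.
Proof.
move=> gV gV' V1 V'1; rewrite leNgt; apply/negP => lt0.
pose D := V - V'.
(* [true] stands for [u] and [false] for [w]. *)
pose F (k : bool) t := (D *m A t p) 0 (if k then 1 else 0).
pose dF (k : bool) t := (D *m A t p *m a (psi t p)) 0 (if k then 1 else 0).
have DF k (t : R) : is_derive t 1 (F k) (dF k t).
  exact: (cocycle_derive D p t).
have D0 : 0 < D 0 0 by rewrite !mxE subr_gt0.
have D1 : D 0 1 = 0 by rewrite !mxE V1 V'1 subrr.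
have F0 : F true 0 = 0 by rewrite /F A0 mulmx1.
have F00 : 0 < F false 0 by rewrite /F A0 mulmx1.
have Fge0 : forall k t, 0 <= t -> 0 <= F k t.
  apply: (@barrier R _ F dF) => [[]|k t t0 Fp Fk].
  - by rewrite F0.
  - exact: ltW.
  (* If both vanished, the transported [D] would be along the flow, hence fixed on the way back to
     time 0, and [D] would have [w = 0]. *)
  have nz : ~ (F true t = 0 /\ F false t = 0).
    move=> [h1 h0]; move: D0.
    rewrite -[D]mulmx1 -(cocycleK t p) mulmxA cocycle_fixed//.
    by rewrite -/(F false t) h0 ltxx.
  have Fp0 := Fp false; have Fp1 := Fp true.
  have cF k' : 0 <= F k' t -> F k' t != 0 -> 0 < F k' t.
    by move=> h1 h2; rewrite lt_neqAle eq_sym h2.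
  rewrite /dF; case: k Fk => Fk; rewrite mulmx3E a2 mulr0 addr0.
  - rewrite a11 mulr0 addr0 mulr_gt0//; last exact: lt_le_trans (a01 _).
    by apply: (cF false) => //; apply/eqP => h; apply: nz.
  - rewrite -/(F false t) Fk mul0r add0r mulr_gt0//;
    last exact: lt_le_trans (a10 _).
    by apply: (cF true) => //; apply/eqP => h; apply: nz.
have [t1 t10 Ft1] : exists2 t1, 0 < t1 & 0 < F true t1.
  have dF0 : 0 < dF true 0.
    rewrite /dF A0 mulmx1 mulmx3E a2 a11 !mulr0 !addr0 mulr_gt0//.
    exact: lt_le_trans (a01 _).
  have := is_derive_gt0_right (DF true 0) dF0.
  move=> /(filterI (nbhs_right_gt (0 : R))) /filter_ex[t [t0]].
  by rewrite F0 => Ft; exists t.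
have [t t0 Ht] := expR_small Ft1.
(* Not before [t1], so that [F true] has not dropped since, and late enough for the [u] of [V] to be
   below [F true t1]. *)
pose T := Num.max t1 (t / (c * d)).
have cd0 : 0 < c * d by rewrite mulr_gt0.
have T0 : 0 <= T by rewrite le_max ltW.
have FT : F true t1 <= F true T.
  apply: (@ger0_derive1_ndecry _ _ 0) => //.
  - move=> s; rewrite in_itv/= andbT => s0.
    rewrite derive1E (@derive_val _ _ _ _ _ _ _ (DF true s)) /dF.
    rewrite mulmx3E a2 a11 !mulr0 !addr0 mulr_ge0//.
      exact: (Fge0 false s (ltW s0)).
    exact: le_trans (ltW c0) (a01 _).
  - by apply: continuous_subspaceT => s; exact: is_derive_cts (DF true s).
  - exact: ltW.
  - by rewrite le_max lexx.
have u't : 0 <= (V' *m A T p) 0 1 by have [] := coneP (gV' _ T0).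
have := cone_orbit_decay gV T0; rewrite V1 mulr1 => uT.
have FTE : F true T = (V *m A T p) 0 1 - (V' *m A T p) 0 1.
  by rewrite /F /D mulmxBl !mxE.
have : expR (- (c * d * T)) <= expR (- t).
  by rewrite ler_expR lerN2 mulrC -ler_pdivrMr// le_max lexx orbT.
by lra.
Qed.

(** Once the [w] agree, the difference is along the flow and does not change under the cocycle,
    while the cone bounds its [s] by a quantity that decays like [u]. *)
Lemma cone_orbit_uniq p V V' : cone_orbit p V -> cone_orbit p V' ->
  V 0 1 = 1 -> V' 0 1 = 1 ->
  V = V'.
Proof.
move=> gV gV' V1 V'1.
have V0 : V 0 0 = V' 0 0.
  by apply/eqP; rewrite eq_le (cone_orbit_le gV gV')// (cone_orbit_le gV' gV).
apply/eqP; rewrite -subr_eq0; apply/eqP; set D := V - V'.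
have D0 : D 0 0 = 0 by rewrite !mxE V0 subrr.
have D1 : D 0 1 = 0 by rewrite !mxE V1 V'1 subrr.
apply: row3P; rewrite [RHS]mxE//.
apply/eqP; rewrite -normr_eq0 eq_le normr_ge0 andbT leNgt; apply/negP => Dpos.
have cd0 : 0 < c * d by rewrite mulr_gt0.
have e0 : 0 < `|D 0 2%:R| / (L + L) by rewrite divr_gt0// addr_gt0.
have [t t0] := expR_small e0; rewrite ltr_pdivlMr ?addr_gt0// => Ht.
pose T := t / (c * d).
have T0 : 0 <= T by rewrite divr_ge0// ltW.
have bound W : cone_orbit p W -> W 0 1 = 1 ->
    `|(W *m A T p) 0 2%:R| <= L * expR (- t).
  move=> gW W1; have [_ _ _ s1 s2] := coneP (gW _ T0).
  have := cone_orbit_decay gW T0; rewrite W1 mulr1 mulrC divfK ?gt_eqF// => h.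
  by have := ler_wpM2l (ltW L0) h; rewrite ler_norml; lra.
have : `|D 0 2%:R| <= L * expR (- t) + L * expR (- t).
  rewrite -(cocycle_fixed T p D0 D1) mulmxBl [X in `|X|]mxE [X in _ + X]mxE.
  by rewrite (le_trans (ler_normB _ _))// lerD// bound.
by rewrite leNgt; apply/negP; rewrite negbK; lra.
Qed.

Lemma coneZ k V : 0 <= k -> cone V -> cone (k *: V).
Proof.
move=> k0 CV j; have := mulr_ge0 k0 (CV j).
by case: j => [[] []] /=; rewrite !mxE; lra.
Qed.

Hypothesis Acont : forall t i j, continuous (fun p => A t p i j).

Lemma lin_continuous k s p (V : 'rV[R]_3) :
  {for (p, V), continuous (fun z : M * 'rV[R]_3 => lin k (z.2 *m A s z.1))}.
Proof.
have cA i j : {for (p, V), continuous (fun z : M * 'rV[R]_3 => A s z.1 i j)}.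
  by apply: (@continuous_comp _ _ _ fst (fun p => A s p i j));
    [exact: cvg_fst|exact: Acont].
have cV j : {for (p, V), continuous (fun z : M * 'rV[R]_3 => z.2 0 j)}.
  by apply: (@continuous_comp _ _ _ snd (fun V : 'rV[R]_3 => V 0 j));
    [exact: cvg_snd|exact: coord_continuous].
have c3 j : {for (p, V), continuous
    (fun z : M * 'rV[R]_3 => (z.2 *m A s z.1) 0 j)}.
  have -> : (fun z : M * 'rV[R]_3 => (z.2 *m A s z.1) 0 j) = fun z =>
      z.2 0 0 * A s z.1 0 j + z.2 0 1 * A s z.1 1 j + z.2 0 2%:R * A s z.1 2%:R j.
    by apply/funext => z; exact: mulmx3E.
  by apply: continuousD; [apply: continuousD|]; apply: continuousM.
case: k => [[] []] /=.
- by apply: continuousD => //; apply: continuousM => //; exact: cst_continuous.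
- by apply: continuousB => //; apply: continuousM => //; exact: cst_continuous.
- by apply: continuousD => //; apply: continuousM => //; exact: cst_continuous.
- apply: continuousB; first exact: continuousN.
  by apply: continuousM => //; exact: cst_continuous.
Qed.

(** The graph of cone orbits is closed. A general filter covers both uses: times going to infinity
    over a fixed point, and base points tending to [p]. For each [s] the cone condition is asked
    only eventually. *)
Lemma cone_orbit_cluster (T : Type) (F : set_system T) (FF : ProperFilter F)
    (x : T -> M) (y : T -> 'rV[R]_3) p V :
  x @ F --> p -> cluster (y @ F) V ->
  (forall s, 0 <= s -> \forall t \near F, cone (y t *m A s (x t))) ->
    cone_orbit p V.
Proof.
move=> xp yV Fc s s0 k; rewrite leNgt; apply/negP => neg.
have [[N1 N2] /= [N1p N2V] N12] : \forall z \near (p, V), lin k (z.2 *m A s z.1) < 0.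
  exact: cvgr_lt _ (@lin_continuous k s p V) _ neg.
pose E := [set t | N1 (x t) /\ cone (y t *m A s (x t))].
have FE : (y @ F) (y @` E).
  apply: (@filterS _ F _ E); first by move=> t Et; exists t.
  by apply: filterI; [exact: xp|exact: Fc].
have [_ [[t [N1t Ct] <-] N2t]] := yV _ _ FE N2V.
have := N12 (x t, y t) (conj N1t N2t); rewrite /= ltNge; apply/negP.
by rewrite negbK; exact: Ct.
Qed.

(** A compact set that contains the slice [u = 1] of the cone. *)
Let box : set 'rV[R]_3 :=
  [set V : 'rV[R]_3 | forall i : 'I_3, (if i == 0 then `[- K, - d]
   else if i == 1 then `[1, 1] else `[- L, L])%classic (V ord0 i)].

Lemma box_compact : compact box.
Proof.
apply: (@rV_compact R 3 (fun i : 'I_3 => if i == 0 then `[- K, - d]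
   else if i == 1 then `[1, 1] else `[- L, L])%classic) => i.
by case: ifP => _; [|case: ifP => _]; exact: segment_compact.
Qed.

Lemma cone_box (V : 'rV[R]_3) : cone V -> V 0 1 = 1 -> box V.
Proof.
move=> /coneP[u0 w1 w2 s1 s2] V1; rewrite V1 in w1 w2 s1 s2.
by apply: ord3P; rewrite /= in_itv/=; lra.
Qed.

Lemma box1 (V : 'rV[R]_3) : box V -> V 0 1 = 1.
Proof.
by move=> /(_ 1); rewrite /= in_itv/= => h; apply/eqP; rewrite eq_le andbC.
Qed.

Lemma psiK t p : psi (- t) (psi t p) = p.
Proof. by rewrite -psiD addNr psi0. Qed.

(** A cone vector over [psi n p] is pulled back to [p], where it is still in the cone by [cone_rev],
    and normalised to [u = 1]. Any cluster point as [n] grows is a solution. *)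
Lemma cone_orbit_exists p : exists V : 'rV[R]_3, V 0 1 = 1 /\ cone_orbit p V.
Proof.
pose V0 : 'rV[R]_3 := \row_j (if j == 0 then - K else if j == 1 then 1 else 0).
have K0 : 0 < K by exact: lt_trans dK.
have V00 : V0 0 0 = - K by rewrite mxE.
have V01 : V0 0 1 = 1 by rewrite mxE.
have V02 : V0 0 2%:R = 0 by rewrite mxE.
have CV0 : cone V0.
  move=> [[] []] /=; rewrite ?V00 ?V01 ?V02 ?mulr1 ?addr0 ?subr0 ?subrr ?opprK//.
  - exact: ltW.
  - exact: ltW.
  - by rewrite subr_ge0 ltW.
have V0n0 : V0 != 0.
  by apply/eqP => /rowP/(_ 1); rewrite V01 mxE => /eqP; rewrite oner_eq0.
pose W (n : nat) := V0 *m A (- n%:R) (psi n%:R p).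
have CW n : cone (W n) by exact: cone_rev.
have Wpos n : 0 < W n 0 1.
  apply: cone_gt0 => //; apply: contra V0n0 => /eqP h.
  by apply/eqP; apply: cocycle_eq0 h.
pose V n := (W n 0 1)^-1 *: W n.
have V1 n : V n 0 1 = 1 by rewrite mxE mulVf// gt_eqF.
have iW n : 0 <= (W n 0 1)^-1 by rewrite invr_ge0 ltW.
have [|X [BX clX]] := @box_compact (V @ \oo) _.
  by exists 0 => // n _; apply: cone_box (V1 n); exact: coneZ.
exists X; split; first exact: box1.
apply: (@cone_orbit_cluster nat \oo _ (fun=> p) V) => //; first exact: cvg_cst.
move=> s s0; near=> n.
(* Pushed forward by [s <= n], the [n]-th vector is, up to its positive factor, the pullback of [V0]
   by time [n - s]. *)
rewrite -scalemxAl; apply: coneZ => //.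
rewrite /W -mulmxA -{2}(psiK n%:R p) -AD -[s - _]opprB.
apply: cone_rev => //; rewrite subr_ge0.
by near: n; exact: nbhs_infty_ger.
Unshelve. all: by end_near. Qed.

(** Uniqueness of normalised cone orbits gives continuity, through compactness and the closed graph,
    and invariance, since a transported cone orbit is again one. *)
Lemma stable_section : exists e : M -> 'rV[R]_3,
  [/\ forall j, continuous (fun p => e p 0 j),
      forall p, e p 0 1 = 1,
      forall p, e p 0 0 < 0 &
      forall t p, exists mu, [/\ mu != 0, e p *m A t p = mu *: e (psi t p) &
        0 <= t -> `|mu| <= expR (- (c * d * t))]].
Proof.
pose e p := projT1 (cid (cone_orbit_exists p)).
have e1 p : e p 0 1 = 1 by have [] := projT2 (cid (cone_orbit_exists p)).
have eg p : cone_orbit p (e p) by have [] := projT2 (cid (cone_orbit_exists p)).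
have eC p : cone (e p) by rewrite -[e p]mulmx1 -(A0 p); exact: eg.
have een0 p : e p != 0.
  by apply/eqP => /rowP/(_ 1); rewrite e1 mxE => /eqP; rewrite oner_eq0.
(* Otherwise the points near [p] with value outside [N] form a proper filter; their values cluster
   in [box], and by uniqueness the cluster point is [e p]. *)
have ects : continuous e.
  move=> p N Nep; apply: contrapT => nN.
  have FF : ProperFilter (within (~` (e @^-1` N)) (nbhs p)).
    apply: Build_ProperFilter_ex => P; rewrite /within/= => nP.
    apply: contrapT => nex; apply: nN; apply: filterS nP => q h.
    by apply: contrapT => nNq; apply: nex; exists q; exact: h.
  have FB : (e @ within (~` (e @^-1` N)) (nbhs p)) box.
    apply: (@filterS _ _ FF setT); last exact: filterT.
    by move=> q _; exact: cone_box (eC q) (e1 q).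
  have [V [BV clV]] := @box_compact _ _ FB.
  have gV : cone_orbit p V.
    apply: (@cone_orbit_cluster M _ FF id e) clV _; first exact: cvg_within.
    by move=> s s0; apply: filterE => q; exact: eg.
  have VE : V = e p by apply: (cone_orbit_uniq gV (eg p)) => //; exact: box1.
  have FN : (e @ within (~` (e @^-1` N)) (nbhs p)) (~` N).
    exact: (@withinT _ (nbhs p) (~` (e @^-1` N))).
  have NV : nbhs V N by rewrite VE.
  by have [q [nNq Nq]] := clV _ _ FN NV.
have fwd t p : 0 <= t -> e p *m A t p = (e p *m A t p) 0 1 *: e (psi t p).
  move=> t0; set X := e p *m A t p.
  have gX : cone_orbit (psi t p) X
    by move=> s s0; rewrite -mulmxA -AD; apply: eg; exact: addr_ge0.
  have X0 : X != 0 by apply: contra (een0 p) => /eqP/cocycle_eq0/eqP.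
  have CX : cone X by exact: eg.
  have Xpos := cone_gt0 CX X0.
  have gX' : cone_orbit (psi t p) ((X 0 1)^-1 *: X).
    by move=> s s0; rewrite -scalemxAl; apply: coneZ;
      [rewrite invr_ge0 ltW|exact: gX].
  rewrite -(cone_orbit_uniq gX' (eg _))// ?scalerA ?divff ?scale1r// ?gt_eqF//.
  by rewrite mxE mulVf// gt_eqF.
exists e; split => //.
- move=> j p; apply: (@continuous_comp _ _ _ e (fun V : 'rV[R]_3 => V 0 j));
  first exact: ects.
  exact: coord_continuous.
- move=> p; have [_ w1 _ _ _] := coneP (eC p).
  by apply: le_lt_trans w1 _; rewrite e1 mulr1 oppr_lt0.
move=> t p; have [t0|t0] := leP 0 t.
  exists ((e p *m A t p) 0 1); split.
  - apply/eqP => h; have := fwd _ p t0; rewrite h scale0r => /cocycle_eq0/eqP.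
    exact/negP.
  - exact: fwd.
  - move=> _; have [u0 _ _ _ _] := coneP (eg p _ t0).
    by rewrite ger0_norm//; have := cone_orbit_decay (eg p) t0; rewrite e1 mulr1.
(* For negative [t], the forward relation at [psi t p] over time [- t] is inverted. *)
have nt0 : 0 <= - t by rewrite oppr_ge0 ltW.
have := fwd _ (psi t p) nt0; rewrite psiK.
set mu := (_ *m _) 0 1 => E.
have mu0 : mu != 0.
  by apply/eqP => h; move: E; rewrite h scale0r => /cocycle_eq0/eqP; exact/negP.
exists mu^-1; split; first by rewrite invr_eq0.
- apply: (scalerI mu0); rewrite scalerA divff// scale1r scalemxAl -E -mulmxA.
  have := cocycleK (- t) (psi t p); rewrite psiK opprK => ->; exact: mulmx1.
- by [].
Qed.

End Cocycle.

(** * Uniform hyperbolicity over a compact base *)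

Lemma compact_pos_lb (R : realType) (M : topologicalType) (f : M -> R) :
  compact [set: M] -> continuous f -> (forall p, 0 < f p) ->
  exists2 c, 0 < c & forall p, c <= f p.
Proof.
move=> Mc fc f0; have [[p _]|M0] := pselect ([set: M] !=set0).
  have [|q _ fq] := @compact_EVT_min M R f [set: M] (ex_intro _ p I) Mc.
    exact: continuous_subspaceT.
  by exists (f q) => // r; apply: fq; rewrite inE.
(* On an empty space any positive constant serves. *)
by exists 1 => // p; case: M0; exists p.
Qed.

Lemma compact_norm_ub (R : realType) (M : topologicalType) (f : M -> R) :
  compact [set: M] -> continuous f -> exists C, forall p, `|f p| <= C.
Proof.
move=> Mc fc; have [[p _]|M0] := pselect ([set: M] !=set0).
  have [|q _ fq] :=
    @compact_EVT_max M R (fun p => `|f p|) [set: M] (ex_intro _ p I) Mc.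
    apply: continuous_subspaceT => q.
    by apply: (@continuous_comp _ _ _ f Num.norm);
      [exact: fc|exact: norm_continuous].
  by exists `|f q| => r; apply: fq; rewrite inE.
by exists 1 => p; case: M0; exists p.
Qed.

Section Hyperbolic.
Variables (R : realType) (M : topologicalType) (psi : R -> M -> M)
  (B : R -> M -> 'M[R]_3) (b : M -> 'M[R]_3) (m : M -> R).
Hypothesis Mc : compact [set: M].
Hypotheses (psi0 : forall p, psi 0 p = p)
  (psiD : forall s t p, psi (s + t) p = psi s (psi t p))
  (psic : continuous (fun z : R * M => psi z.1 z.2)).
Hypotheses (B0 : forall p, B 0 p = 1%:M)
  (BD : forall s t p, B (s + t) p = B t p *m B s (psi t p))
  (Bcont : forall t i j, continuous (fun p => B t p i j)).
Hypothesis Bder : forall p i j,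
  is_derive (0 : R) 1 (fun t : R => B t p i j) (b p i j).
Hypothesis bcont : forall i j, continuous (fun p => b p i j).
Hypotheses (mc : continuous m) (m0 : forall p, m p != 0).
Hypothesis B2 : forall t p,
  [/\ B t p 2%:R 0 = 0, B t p 2%:R 1 = 0 & m p * B t p 2%:R 2%:R = m (psi t p)].
Hypotheses (b11 : forall p, b p 1 1 = 0)
  (bpos : forall p, 0 < b p 0 1 * b p 1 0).

Variable eps : R.
Hypothesis eps2 : eps * eps = 1.

(* [w] is multiplied by the sign of [f] and [s] divided by the speed [m] of the
   field, so that the field gets the constant coordinates (0, 0, 1). Time is
   reversed for [eps = -1]; the extra sign on [w] restores [f, g > 0]. *)
Let sigma p := eps * Num.sg (b p 0 1).
Let delta p (i : 'I_3) := if i == 0 then sigma p else if i == 1 then 1 else m p.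
Let D p : 'M[R]_3 := diag_mx (\row_i delta p i).
Let Di p : 'M[R]_3 := diag_mx (\row_i (delta p i)^-1).
Let A t p := D p *m B (eps * t) p *m Di (psi (eps * t) p).

Lemma psi_cont_p t : continuous (psi t).
Proof.
move=> p; apply: (@continuous_comp _ _ _ (fun p => (t, p)) (fun z => psi z.1 z.2)).
  exact: cvg_pair (cvg_cst t) cvg_id.
exact: psic.
Qed.

Lemma psi_cont_t p : continuous (psi ^~ p).
Proof.
move=> t; apply: (@continuous_comp _ _ _ (fun t => (t, p)) (fun z => psi z.1 z.2)).
  exact: cvg_pair cvg_id (cvg_cst p).
exact: psic.
Qed.

Lemma b01n0 p : b p 0 1 != 0.
Proof. by apply/eqP => h; have := bpos p; rewrite h mul0r ltxx. Qed.

Lemma b10n0 p : b p 1 0 != 0.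
Proof. by apply/eqP => h; have := bpos p; rewrite h mulr0 ltxx. Qed.

Lemma sigma2 p : sigma p * sigma p = 1.
Proof.
rewrite /sigma mulrACA eps2 mul1r -expr2 sqr_sg b01n0//.
Qed.

Lemma sigmaV p : (sigma p)^-1 = sigma p.
Proof.
have s0 : sigma p != 0.
  by apply/eqP => h; have /eqP := sigma2 p; rewrite h mul0r eq_sym oner_eq0.
by apply: (mulfI s0); rewrite sigma2 divff.
Qed.

(** [b p 0 1] is continuous and never vanishes, so its sign is locally constant. *)
Lemma sigma_near p : \forall q \near p, sigma q = sigma p.
Proof.
have := b01n0 p; rewrite neq_lt => /orP[lt0|gt0].
- have : \forall q \near p, b q 0 1 < 0 by exact: cvgr_lt _ (@bcont 0 1 p) _ lt0.
  by apply: filterS => q; rewrite /sigma => h; rewrite !ltr0_sg.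
- have : \forall q \near p, 0 < b q 0 1 by exact: cvgr_gt _ (@bcont 0 1 p) _ gt0.
  by apply: filterS => q; rewrite /sigma => h; rewrite !gtr0_sg.
Qed.

Lemma sigma_cont : continuous sigma.
Proof.
move=> p; apply: cvg_near_cst; exact: sigma_near.
Qed.

Lemma delta_n0 p i : delta p i != 0.
Proof.
rewrite /delta; case: ifP => _; last by case: ifP.
by apply/eqP => h; have /eqP := sigma2 p; rewrite h mul0r eq_sym oner_eq0.
Qed.

Lemma delta_cont i : continuous (delta ^~ i).
Proof.
by move: i; apply: ord3P; [exact: sigma_cont|exact: cst_continuous|exact: mc].
Qed.

Lemma AE t p i j :
  A t p i j = delta p i * B (eps * t) p i j / delta (psi (eps * t) p) j.
Proof. by rewrite /A /D /Di mul_mx_diag mul_diag_mx !mxE. Qed.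

Lemma DiK p : Di p *m D p = 1%:M.
Proof.
rewrite /D /Di mulmx_diag; apply/matrixP => i j; rewrite !mxE.
by rewrite mulVf// delta_n0.
Qed.

Lemma DKi p : D p *m Di p = 1%:M.
Proof. exact/mulmx1C/DiK. Qed.

(** The generator of [A]. Differentiating the inverse speed along the orbit only subtracts
    [b p 2%:R 2%:R] from the last diagonal entry, which becomes 0; the locally constant [sigma] adds
    no term. *)
Let a p : 'M[R]_3 := \matrix_(i, j)
  (eps * delta p i * (b p i j - (if (i == 2%:R) && (j == 2%:R) then b p 2%:R 2%:R else 0))
    / delta p j).

Lemma Beps_der p i j :
  is_derive (0 : R) 1 (fun t : R => B (eps * t) p i j) (eps * b p i j).
Proof.
have H1 : is_derive (0 : R) 1 (fun t : R => eps * t) eps.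
  have := is_deriveZ eps (is_derive_id (0 : R) (1 : R)).
  by rewrite [_%:A]mulr1.
have H0 : is_derive (eps * 0) 1 (fun t : R => B t p i j) (b p i j).
  by rewrite mulr0.
by have := is_derive1_comp H0 H1; rewrite mulrC.
Qed.

Lemma A_der p i j : is_derive (0 : R) 1 (fun t : R => A t p i j) (a p i j).
Proof.
have -> : (fun t : R => A t p i j) =
  (fun t => delta p i * B (eps * t) p i j / delta (psi (eps * t) p) j).
  by apply/funext => t; exact: AE.
have ij2 k : k != 2%:R -> eps * b p i k / delta p k * delta p i =
    eps * delta p i * (b p i k - (if (i == 2%:R) && (k == 2%:R) then b p 2%:R 2%:R else 0)) / delta p k.
  by move=> /negPf ->; rewrite andbF subr0; ring.
rewrite mxE; move: j; apply: ord3P.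
(* Near time 0 [sigma] is constant along the orbit, so the denominator can be frozen at [p]. *)
- have near0 : \forall t \near (0 : R), (delta p i / sigma p) * B (eps * t) p i 0 =
      delta p i * B (eps * t) p i 0 / delta (psi (eps * t) p) 0.
    have ce : {for (0 : R), continuous (fun t : R => psi (eps * t) p)}.
      apply: (@continuous_comp R R M (fun t => eps * t) (psi ^~ p)).
        exact: mulrl_continuous.
      exact: psi_cont_t.
    have sn : nbhs (psi (eps * 0) p) [set q | sigma q = sigma p].
      by rewrite mulr0 psi0; exact: sigma_near.
    have := ce _ sn; rewrite nbhs_filterE; apply: (@filterS _ (nbhs (0:R))) => t.
    by rewrite /= /delta /= => ->; rewrite mulrAC.
  apply: (near_eq_is_derive near0).
  apply: is_derive_eq;
    first exact: (is_deriveZ (delta p i / sigma p) (Beps_der p i 0)).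
  by rewrite -ij2// /GRing.scale /= -[delta p 0]/(sigma p); ring.
- have -> : (fun t => delta p i * B (eps * t) p i 1 / delta (psi (eps * t) p) 1) =
      (delta p i) \*: (fun t : R => B (eps * t) p i 1).
    by apply/funext => t; rewrite /delta /= divr1.
  apply: is_derive_eq; first exact: (is_deriveZ (delta p i) (Beps_der p i 1)).
  by rewrite -ij2// /GRing.scale /= -[delta p 1]/1 divr1; ring.
(* Along an orbit the speed is a multiple of an entry of [B], hence differentiable at time 0,
   although [m] is only assumed continuous. *)
- have mE t : m (psi t p) = m p * B t p 2%:R 2%:R by have [_ _ ->] := B2 t p.
  have B22 t : B t p 2%:R 2%:R != 0.
    by apply/eqP => h; move: (m0 (psi t p)); rewrite mE h mulr0 eqxx.
  have -> : (fun t => delta p i * B (eps * t) p i 2%:R / delta (psi (eps * t) p) 2%:R) =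
      (delta p i / m p) \*: ((fun t : R => B (eps * t) p i 2%:R) *
         (fun t => (B (eps * t) p 2%:R 2%:R)^-1)).
    apply/funext => t.
    rewrite -[RHS]/(delta p i / m p *
      (B (eps * t) p i 2%:R / B (eps * t) p 2%:R 2%:R)).
    by rewrite -[delta (psi _ _) _]/(m (psi (eps * t) p)) mE invfM; ring.
  have H3 := is_deriveV (B22 (eps * 0)) (Beps_der p 2%:R 2%:R).
  apply: is_derive_eq.
    exact: (is_deriveZ (delta p i / m p) (is_deriveM (Beps_der p i 2%:R) H3)).
  rewrite /GRing.scale /= mulr0 B0 !mxE eqxx andbT -[delta p 2%:R]/(m p).
  by case: (i == 2%:R) => /=; field; rewrite ?m0.
Qed.

Lemma b2j p : b p 2%:R 0 = 0 /\ b p 2%:R 1 = 0.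
Proof.
split.
- rewrite -(@derive_val _ _ _ _ _ _ _ (Bder p 2%:R 0)).
  have -> : (fun t : R => B t p 2%:R 0) = cst 0.
    by apply/funext => t; have [-> _ _] := B2 t p.
  exact: derive_cst.
- rewrite -(@derive_val _ _ _ _ _ _ _ (Bder p 2%:R 1)).
  have -> : (fun t : R => B t p 2%:R 1) = cst 0.
    by apply/funext => t; have [_ -> _] := B2 t p.
  exact: derive_cst.
Qed.

Lemma a_cont i j : continuous (fun p => a p i j).
Proof.
have -> : (fun p => a p i j) = fun p => (eps * delta p i *
    (b p i j - (if (i == 2%:R) && (j == 2%:R) then b p 2%:R 2%:R else 0)))
    * (delta p j)^-1.
  by apply/funext => p; rewrite mxE.
move=> p; apply: cvgM.
  apply: cvgM.
    by apply: cvgM; [exact: cvg_cst|exact: delta_cont].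
  apply: cvgB; first exact: bcont.
  by case: ifP => _; [exact: bcont|exact: cvg_cst].
apply: cvgV; [exact: delta_n0|exact: delta_cont].
Qed.

Lemma A_cont t i j : continuous (fun p => A t p i j).
Proof.
have -> : (fun p => A t p i j) = fun p =>
    delta p i * B (eps * t) p i j * (delta (psi (eps * t) p) j)^-1.
  by apply/funext => p; rewrite AE.
move=> p; apply: cvgM.
  by apply: cvgM; [exact: delta_cont|exact: Bcont].
apply: cvgV; first exact: delta_n0.
apply: (@continuous_comp _ _ _ (psi (eps * t)) (delta ^~ j)).
  exact: psi_cont_p.
exact: delta_cont.
Qed.

(** [stable_section] is applied to the rescaled cocycle [A] and its result carried back by [D]. The
    sign in the third clause will separate the sections for the two values of [eps]. *)
Lemma hyperbolic_section : exists (e : M -> 'rV[R]_3) (lam : R),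
  [/\ forall j, continuous (fun p => e p 0 j),
      0 < lam /\ forall p, e p 0 1 = 1,
      forall p, eps * b p 0 1 * e p 0 0 < 0 &
      forall t p, exists mu, [/\ mu != 0,
        e p *m B (eps * t) p = mu *: e (psi (eps * t) p) &
        0 <= t -> `|mu| <= expR (- (lam * t))]].
Proof.
have a01E p : a p 0 1 = `|b p 0 1|.
  rewrite mxE /= subr0 divr1 -[delta p 0]/(sigma p) /sigma mulrA eps2 mul1r.
  by rewrite normrEsg.
(* Because the two entries have the same sign, the single factor [sigma] makes both positive. *)
have sgb p : Num.sg (b p 0 1) = Num.sg (b p 1 0).
  by have := gtr0_sg (bpos p); rewrite sgrM; case: sgrP; case: sgrP => _ _; lra.
have a10E p : a p 1 0 = `|b p 1 0|.
  rewrite mxE /= subr0 mulr1 -[delta p 0]/(sigma p) sigmaV /sigma.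
  rewrite normrEsg sgb; set s := Num.sg _; set x := b p 1 0.
  have -> : eps * x * (eps * s) = eps * eps * (s * x) by ring.
  by rewrite eps2 mul1r.
have pos1 p : 0 < a p 0 1 by rewrite a01E normr_gt0; exact: b01n0.
have pos2 p : 0 < a p 1 0 by rewrite a10E normr_gt0; exact: b10n0.
have [c1 c10 Hc1] := @compact_pos_lb R M (fun p => a p 0 1) Mc (@a_cont 0 1) pos1.
have [c2 c20 Hc2] := @compact_pos_lb R M (fun p => a p 1 0) Mc (@a_cont 1 0) pos2.
pose Cf i j := projT1 (cid (compact_norm_ub Mc (@a_cont i j))).
have Cf_ub i j p : `|a p i j| <= `|Cf i j|.
  by apply: le_trans (ler_norm _);
    exact: (projT2 (cid (compact_norm_ub Mc (@a_cont i j)))).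
pose c := Num.min c1 c2.
pose C := c + \sum_i \sum_j `|Cf i j|.
have c0 : 0 < c by rewrite lt_min c10 c20.
have cC : c <= C by rewrite lerDl; apply: sumr_ge0 => i _; exact: sumr_ge0.
have C0 : 0 < C by exact: lt_le_trans cC.
have aC p i j : `|a p i j| <= C.
  rewrite (le_trans (Cf_ub i j p))// (le_trans _ (ler_wpDl (ltW c0) (lexx _)))//.
  rewrite (bigD1 i)//= (bigD1 j)//= -addrA lerDl addr_ge0//.
    exact: sumr_ge0.
  by apply: sumr_ge0 => k _; exact: sumr_ge0.
(* [C d = c / 3] with [d <= 1 / 3] gives [Hd]; [c K = c + 2 C] with [K > 1] gives [HK];
   [L c d = C (1 + K) + c d] gives [HL]. *)
pose d := c / (3 * C).
pose K := 1 + 2 * C / c.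
pose L := C * (1 + K) / (c * d) + 1.
have d0 : 0 < d by rewrite divr_gt0// mulr_gt0.
have Cd : C * d = c / 3 by rewrite /d; field; rewrite gt_eqF.
have cK : c * K = c + 2 * C by rewrite /K; field; rewrite gt_eqF.
have d1 : d <= 1 / 3.
  by rewrite -(ler_pM2l C0) Cd; lra.
have K1 : 1 < K by rewrite ltrDl divr_gt0// mulr_gt0.
have cd0 : 0 < c * d by rewrite mulr_gt0.
have L1 : 0 < L by rewrite addr_gt0// divr_gt0// mulr_gt0// addr_gt0//; lra.
have dK : d < K by lra.
have Hd : C * d + C * d * d < c by rewrite Cd; nra.
have HK : C + C * K < K * K * c.
  have -> : K * K * c = K * (c * K) by ring.
  by rewrite cK; nra.
have HL : C * (1 + K) < L * c * d.
  have -> : L * c * d = C * (1 + K) + c * d.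
    by rewrite /L; field; rewrite !gt_eqF.
  by rewrite ltrDl.
have [] := @stable_section R M (fun t => psi (eps * t)) A a _ _ _ _ A_der
   c C d K L c0 d0 dK L1 Hd HK HL _ _ aC _ _ _ A_cont.
- by move=> p; rewrite mulr0 psi0.
- by move=> s t p; rewrite mulrDr psiD.
- by move=> p; rewrite /A mulr0 B0 psi0 mulmx1 DKi.
- move=> s t p; rewrite /A mulrDr BD psiD !mulmxA; congr (_ *m _ *m _).
  by rewrite -!mulmxA DiK mulmx1.
- by move=> p; rewrite (le_trans _ (Hc1 p))// ge_min lexx.
- by move=> p; rewrite (le_trans _ (Hc2 p))// ge_min lexx orbT.
- by move=> p; rewrite mxE /= b11 subr0 mulr0 mul0r.
- move=> p j; rewrite mxE; have [b20 b21] := b2j p.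
  by move: j; apply: ord3P; rewrite /= ?b20 ?b21 ?subrr ?subr0 mulr0 mul0r.
- move=> t p; have [h0 h1 h2] := B2 (eps * t) p; rewrite !AE h0 h1 !mulr0 !mul0r.
  split => //; rewrite -[delta p 2%:R]/(m p) h2 -[delta _ 2%:R]/(m _) divff//.
move=> e [ec e1 e0 einv].
have De p : (e p *m D p) = \row_j (e p 0 j * delta p j)
  by rewrite mul_mx_diag; apply/rowP => j; rewrite !mxE.
(* [D] leaves the coordinate [u] unchanged, so the normalisation survives. *)
exists (fun p => e p *m D p), (c * d); split.
- move=> j; have -> : (fun p => (e p *m D p) 0 j) = fun p => e p 0 j * delta p j.
    by apply/funext => p; rewrite De mxE.
  by move=> p; apply: cvgM; [exact: ec|exact: delta_cont].
- by split => // p; rewrite De mxE e1 mul1r.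
- move=> p; rewrite De mxE -[delta p 0]/(sigma p) /sigma.
  have -> : eps * b p 0 1 * (e p 0 0 * (eps * Num.sg (b p 0 1))) =
    eps * eps * (Num.sg (b p 0 1) * b p 0 1) * e p 0 0 by ring.
  by rewrite eps2 mul1r -normrEsg pmulr_rlt0 ?normr_gt0 ?b01n0.
- move=> t p; have [mu [mu0 E H]] := einv t p.
  exists mu; split => //.
  by rewrite scalemxAl -E /A -!mulmxA DiK mulmx1.
Qed.

End Hyperbolic.

(** * Calculus in charts *)

Section Mixed.
Variable R : realType.

Lemma is_derive0_eps (f : R -> R) (d : R) :
  (forall eps, 0 < eps -> exists2 delta, 0 < delta & forall h, h != 0 ->
     `|h| < delta -> `|h^-1 * (f h - f 0) - d| <= eps) ->
  is_derive (0 : R) 1 f d.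
Proof.
move=> H.
have cv : (h^-1 *: ((f \o shift 0) (h *: (1 : R)) - f 0)) @[h --> 0^'] --> d.
  apply/cvgrPdist_le => e e0; have [r r0 Hr] := H e e0.
  rewrite near_withinE nearE; apply/nbhs_ballP; exists r => //= h.
  rewrite /ball/= sub0r normrN => hr h0.
  by rewrite distrC [_%:A]mulr1 addr0 /GRing.scale/=; exact: Hr.
split; first by apply/cvg_ex; exists d.
exact: cvg_lim cv.
Qed.

Lemma is_derive0_bound (f : R -> R) (d k eps delta : R) :
  is_derive (0 : R) 1 f d -> 0 < delta ->
  (forall h, h != 0 -> `|h| < delta -> `|h^-1 * (f h - f 0) - k| <= eps) ->
  `|d - k| <= eps.
Proof.
move=> [fd fdE] delta0 H; rewrite leNgt; apply/negP => lt.
have cv : (h^-1 *: ((f \o shift 0) (h *: (1 : R)) - f 0)) @[h --> 0^'] --> d.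
  by rewrite -fdE; exact: fd.
have e0 : 0 < `|d - k| - eps by rewrite subr_gt0.
move/cvgrPdist_lt : cv => /(_ _ e0).
rewrite near_withinE nearE => /nbhs_ballP[r /= r0 Hr].
pose h := Num.min r delta / 2.
have m0 : 0 < Num.min r delta by rewrite lt_min r0.
have h0 : 0 < h by rewrite divr_gt0.
have hm : h < Num.min r delta by rewrite /h; lra.
have := Hr h; rewrite /ball/= sub0r normrN gtr0_norm// => /(_ (lt_le_trans hm _)).
rewrite ge_min lexx => /(_ isT (lt0r_neq0 h0)).
rewrite [_%:A]mulr1 addr0 /GRing.scale/= => H1.
have := H h (lt0r_neq0 h0); rewrite gtr0_norm// => /(_ (lt_le_trans hm _)).
rewrite ge_min lexx orbT => /(_ isT) H2.
have := ler_normD (d - h^-1 * (f h - f 0)) (h^-1 * (f h - f 0) - k).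
by rewrite addrA subrK; lra.
Qed.

Lemma MVT0 (f df : R -> R) (r h : R) :
  (forall x : R, `|x| < r -> is_derive x 1 f (df x)) -> `|h| < r ->
  exists2 c, `|c| <= `|h| & f h - f 0 = df c * h.
Proof.
move=> fd hr; have [h0|h0] := leP 0 h.
- rewrite (ger0_norm h0) in hr *.
  have dom c : c \in `[0, h] -> `|c| < r.
    by rewrite in_itv/= => /andP[c0 ch]; rewrite ger0_norm//; lra.
  have [||c ch ->] := @MVT_segment R f df 0 h h0.
  + by move=> x xh; apply/fd/dom; exact: subset_itv_oo_cc xh.
  + apply: derivable_within_continuous => x xh.
    by have [] := fd _ (dom _ xh).
  + by exists c;
    [move: ch; rewrite in_itv/= => /andP[c0 ch]; rewrite ger0_norm|rewrite subr0].
- rewrite (ltr0_norm h0) in hr *.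
  have dom c : c \in `[h, 0] -> `|c| < r.
    by rewrite in_itv/= => /andP[c0 ch]; rewrite ler0_norm//; lra.
  have [||c ch E] := @MVT_segment R f df h 0 (ltW h0).
  + by move=> x xh; apply/fd/dom; exact: subset_itv_oo_cc xh.
  + apply: derivable_within_continuous => x xh.
    by have [] := fd _ (dom _ xh).
  + exists c; first
    by move: ch; rewrite in_itv/= => /andP[c0 ch]; rewrite ler0_norm//; lra.
    by rewrite -[LHS]opprB E sub0r mulrN opprK.
Qed.

(* Exchange of derivatives: the double difference of P over [0, h] x [0, e] is
   h e S(c, c') by two applications of the mean value theorem. *)
Lemma mixed_derivative (P Q S : R -> R -> R) (G : R -> R) (r : R) : 0 < r ->
  (forall t e : R, `|t| < r -> `|e| < r -> is_derive t 1 (P ^~ e) (Q t e)) ->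
  (forall t e : R, `|t| < r -> `|e| < r -> is_derive e 1 (Q t) (S t e)) ->
  (forall t : R, `|t| < r -> is_derive (0 : R) 1 (P t) (G t)) ->
  (forall eps, 0 < eps -> exists2 delta, 0 < delta & forall t e : R,
     `|t| < delta -> `|e| < delta -> `|S t e - S 0 0| <= eps) ->
  is_derive (0 : R) 1 G (S 0 0).
Proof.
move=> r0 PQ QS PG Sc; apply: is_derive0_eps => eps eps0.
have [d d0 Hd] := Sc eps eps0.
exists (Num.min r d); first by rewrite lt_min r0.
move=> h h0; rewrite lt_min => /andP[hr hd].
have r00 : `|0 : R| < r by rewrite normr0.
have fd : is_derive (0 : R) 1 (P h - P 0) (G h - G 0).
  exact: is_deriveB (PG h hr) (PG 0 r00).
suff : `|(G h - G 0) - h * S 0 0| <= `|h| * eps.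
  move=> H; rewrite -(ler_pM2l (_ : 0 < `|h|)) ?normr_gt0//.
  by rewrite -normrM mulrBr mulrA divff// mul1r.
(* For fixed [h], a bound on the difference quotients of [P h - P 0] in [e] passes to its derivative
   [G h - G 0]. *)
apply: (is_derive0_bound fd (_ : 0 < Num.min r d)); first by rewrite lt_min r0.
move=> e e0; rewrite lt_min => /andP[er ed].
have [t th E1] : exists2 c, `|c| <= `|h| &
    (P h e - P h 0) - (P 0 e - P 0 0) = (Q c e - Q c 0) * h.
  apply: (@MVT0 (fun t => P t e - P t 0) (fun t => Q t e - Q t 0) r) => // x xr.
  exact: is_deriveB (PQ x e xr er) (PQ x 0 xr r00).
have tr : `|t| < r by exact: le_lt_trans hr.
have [x xe E2] := @MVT0 (Q t) (S t) r e (fun x xr => QS t x tr xr) er.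
have -> : e^-1 * ((P h - P 0) e - (P h - P 0) 0) - h * S 0 0 =
    h * (S t x - S 0 0).
  rewrite [(P h - P 0) e]/(P h e - P 0 e) [(P h - P 0) 0]/(P h 0 - P 0 0).
  have -> : P h e - P 0 e - (P h 0 - P 0 0) = P h e - P h 0 - (P 0 e - P 0 0)
    by ring.
  by rewrite E1 E2; field.
rewrite normrM ler_wpM2l//; apply: Hd;
  [exact: le_lt_trans hd|exact: le_lt_trans ed].
Qed.

End Mixed.

(** * Limits of matrices and chain rules *)

Section MatrixLimits.
Context {R : realType} {T : Type} {F : set_system T} {FF : Filter F}.

Lemma cvg_mx m n (f : T -> 'M[R]_(m, n)) (A : 'M[R]_(m, n)) :
  (forall i j, f t i j @[t --> F] --> A i j) -> f @ F --> A.
Proof.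
move=> H; apply/cvgrPdist_le => e e0; near=> t.
rewrite /Num.Def.normr/= mx_normrE (bigmax_le _ (ltW e0))//= => i _.
rewrite !mxE/=; move: i; near: t; apply: filter_forall => i.
exact: ((cvgrPdist_le _ _).1 (H i.1 i.2)).
Unshelve. all: by end_near. Qed.

Lemma cvg_mx_coord m n (f : T -> 'M[R]_(m, n)) (A : 'M[R]_(m, n)) i j :
  f @ F --> A -> f t i j @[t --> F] --> A i j.
Proof.
move=> fA.
exact: (@cvg_comp _ _ _ f (fun B : 'M[R]_(m, n) => B i j) _ _ _ fA
  (@coord_continuous R m n i j A)).
Qed.

Lemma cvg_sum (I : finType) (f : I -> T -> R) (l : I -> R) :
  (forall i, f i t @[t --> F] --> l i) ->
  (\sum_i f i t) @[t --> F] --> \sum_i l i.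
Proof. by move=> H; apply: cvg_big => // x; exact: add_continuous. Qed.

Lemma cvg_prod (I : finType) (f : I -> T -> R) (l : I -> R) :
  (forall i, f i t @[t --> F] --> l i) ->
  (\prod_i f i t) @[t --> F] --> \prod_i l i.
Proof. by move=> H; apply: cvg_big => // x; exact: mul_continuous. Qed.

Lemma cvg_mulmx m n p (f : T -> 'M[R]_(m, n)) (g : T -> 'M[R]_(n, p))
  (A : 'M[R]_(m, n)) (B : 'M[R]_(n, p)) :
  f @ F --> A -> g @ F --> B -> (f t *m g t) @[t --> F] --> A *m B.
Proof.
move=> fA gB; apply: cvg_mx => i j.
have -> : (fun t => (f t *m g t) i j) = fun t => \sum_k f t i k * g t k j.
  by apply/funext => t; rewrite mxE.
rewrite mxE; apply: cvg_sum => k.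
by apply: cvgM; exact: cvg_mx_coord.
Qed.

Lemma cvg_det n (f : T -> 'M[R]_n) (A : 'M[R]_n) :
  f @ F --> A -> \det (f t) @[t --> F] --> \det A.
Proof.
move=> fA; apply: cvg_sum => s.
apply: cvgM; first exact: cvg_cst.
by apply: cvg_prod => i; exact: cvg_mx_coord.
Qed.

(** The determinant is eventually nonzero, so the inverse is eventually given by Cramer's
    formula. *)
Lemma cvg_invmx n (f : T -> 'M[R]_n) (A : 'M[R]_n) : A \in unitmx ->
  f @ F --> A -> invmx (f t) @[t --> F] --> invmx A.
Proof.
move=> uA fA.
have detA : \det A != 0 by rewrite -unitfE -unitmxE.
have dfA := cvg_det fA.
have E : \forall t \near F, (\det (f t))^-1 *: \adj (f t) = invmx (f t).
  have : \forall t \near F, \det (f t) != 0 by exact: cvgr_neq0 dfA detA.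
  by apply: filterS => t ft; rewrite /invmx unitmxE unitfE ft.
apply: cvg_trans; first exact: (near_eq_cvg E).
rewrite /invmx uA; apply: cvgZ; first exact: cvgV.
apply: cvg_mx => i j.
have -> : (fun t => (\adj (f t)) i j) =
    fun t => (-1) ^+ (j + i) * \det (row' j (col' i (f t))).
  by apply/funext => t; rewrite mxE.
rewrite mxE; apply: cvgM; first exact: cvg_cst.
apply: cvg_det; apply: cvg_mx => k l.
have -> : (fun t => (row' j (col' i (f t))) k l) = fun t => f t (lift j k) (lift i l).
  by apply/funext => t; rewrite !mxE.
by rewrite !mxE; exact: cvg_mx_coord.
Qed.

End MatrixLimits.

Lemma near_eq_diff (R : realType) (V W : normedModType R) (f g : V -> W) x v :
  (\forall y \near x, f y = g y) -> differentiable f x -> differentiable g x ->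
  'd f x v = 'd g x v.
Proof.
by move=> fg df dg; rewrite -!deriveE//; exact: near_eq_derive.
Qed.

Lemma near_eq_continuous (T U : topologicalType) (f g : T -> U) x :
  (\forall y \near x, f y = g y) -> {for x, continuous f} ->
  {for x, continuous g}.
Proof.
move=> fg cf A; rewrite -(nbhs_singleton fg) => /cf fA.
by apply: filterS2 fg fA => y /= <-.
Qed.

Lemma diff_compE (R : realType) (U V W : normedModType R) (f : U -> V)
    (g : V -> W) x v : differentiable f x -> differentiable g (f x) ->
  'd (g \o f) x v = 'd g (f x) ('d f x v).
Proof. by move=> df dg; rewrite diff_comp. Qed.

Lemma is_derive_comp_diff (R : realType) (V W : normedModType R) (c : R -> V)
    (g : V -> W) (t : R) (dc : V) : is_derive t 1 c dc ->
  differentiable g (c t) -> is_derive t 1 (g \o c) ('d g (c t) dc).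
Proof.
move=> [cd <-] dg; have dc' : differentiable c t by exact/derivable1_diffP.
have dgc := differentiable_comp dc' dg.
split; first exact: diff_derivable dgc.
have -> : 'D_1 c t = 'd c t 1 by exact: (@deriveE _ _ _ c t 1 dc').
transitivity ('d (g \o c) t 1); first exact: (@deriveE _ _ _ (g \o c) t 1 dgc).
exact: diff_compE.
Qed.

Lemma is_derive_mx (R : realType) (V : normedModType R) m n
    (f : V -> 'M[R]_(m, n)) (x v : V) df i j :
  is_derive x v f df -> is_derive x v (fun y => f y i j) (df i j).
Proof.
move=> [fd <-]; split; first exact: (derivable_mxP _ _ _).1.
by rewrite derive_mx// mxE.
Qed.

(** * The flow read in charts *)

Section Charts.
Context (R : realType) (M : closed_oriented_3manifold R).
Variables (Y : field M) (psi : R -> M -> M).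
Hypotheses (Y1 : vector_field 1 Y) (psiY : flow_of Y psi).

Local Notation lf := (local_flow psi).
Local Notation fo := (flow_overlap psi).

Lemma flow0 p : psi 0 p = p. Proof. by have [] := psiY. Qed.
Lemma flowD s t p : psi (s + t) p = psi s (psi t p).
Proof. by have [] := psiY. Qed.

Lemma local_flow0 i j : lf i j 0 = transition i j.
Proof. by apply/funext => x; rewrite /local_flow flow0. Qed.

Lemma flow_overlap0 i j : fo i j 0 = overlap i j.
Proof. by apply/seteqP; split => x; rewrite /flow_overlap/= flow0. Qed.

Lemma flow_overlap_id i x : cod i x -> fo i i 0 x.
Proof. by move=> xi; split=> //; rewrite flow0; exact: param_dom. Qed.

Lemma cod_lf i j t x : fo i j t x -> cod j (lf i j t x).
Proof. by move=> [_ H]; exact: coord_cod. Qed.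

Lemma param_lf i j t x : fo i j t x -> param j (lf i j t x) = psi t (param i x).
Proof. by move=> [_ H]; rewrite coordK. Qed.

Lemma flow_overlapD i j k s t x : fo i j t x ->
  fo j k s (lf i j t x) <-> dom k (psi (s + t) (param i x)).
Proof.
move=> H; rewrite /flow_overlap/= param_lf// flowD.
by split=> [[]//|]; split=> //; exact: cod_lf.
Qed.

Lemma local_flowD i j k s t x : fo i j t x ->
  lf j k s (lf i j t x) = lf i k (s + t) x.
Proof. by move=> H; rewrite /local_flow -/(lf i j t x) param_lf// flowD. Qed.

Lemma near_flow_overlap i j t x : fo i j t x ->
  \forall z \near (t, x), fo i j z.1 z.2.
Proof.
move=> [xi xj]; have [_ _ _ psic _] := psiY.
have H1 : \forall z \near (t, x), cod i z.2.
  have : \forall y \near x, cod i y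
    by apply: open_nbhs_nbhs; split => //; exact: open_cod.
  exact: cvg_snd.
have H2 : \forall z \near (t, x), dom j (psi z.1 (param i z.2)).
  have c2 : {for (t, x), continuous (fun z : R * 'rV[R]_3 => psi z.1 (param i z.2))}.
    apply: (@continuous_comp _ _ _ (fun z : R * 'rV[R]_3 => (z.1, param i z.2))
      (fun z => psi z.1 z.2)); last exact: psic.
    have cp : {for (t, x), continuous (fun z : R * 'rV[R]_3 => param i z.2)}.
      apply: (@continuous_comp _ _ _ snd (param i)); first exact: cvg_snd.
      exact: continuous_param.
    exact: cvg_pair cvg_fst cp.
  apply: c2; apply: open_nbhs_nbhs; split => //; exact: open_dom.
by apply: filterS2 H1 H2 => z; split.
Qed.

Lemma pair_diff (t : R) (x : 'rV[R]_3) : differentiable (fun y : 'rV[R]_3 => (t, y)) x.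
Proof. exact: differentiable_pair. Qed.

Lemma pair_diff_l (t : R) (x : 'rV[R]_3) : differentiable (fun s : R => (s, x)) t.
Proof. exact: differentiable_pair. Qed.

Lemma near_flow_overlap_x i j t x : fo i j t x ->
  \forall y \near x, fo i j t y.
Proof.
move=> /near_flow_overlap H.
have c : {for x, continuous (fun y : 'rV[R]_3 => (t, y))}.
  exact: differentiable_continuous (pair_diff t x).
exact: c _ H.
Qed.

Let joint i j (z : R * 'rV[R]_3) := lf i j z.1 z.2.

Lemma joint_diff i j t x : fo i j t x -> differentiable (joint i j) (t, x).
Proof. by move=> H; have [_ _ _ _ /(_ i j)[/(_ (t, x) H)]] := psiY. Qed.

Lemma local_flow_diff i j t x : fo i j t x -> differentiable (lf i j t) x.
Proof.
move=> H; apply: (@differentiable_comp _ _ _ _ (fun y => (t, y)) (joint i j)).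
  exact: pair_diff.
exact: joint_diff.
Qed.

(** [flow_of] provides a [C^1] map of time and point jointly. Spatial differentials are its
    differential on vectors [(0, v)], and their continuity in both variables follows from this. *)
Lemma diff_joint i j t x v : fo i j t x ->
  'd (lf i j t) x v = 'd (joint i j) (t, x) (0, v).
Proof.
move=> H; rewrite -[lf i j t]/(joint i j \o (fun y => (t, y))).
rewrite (diff_compE v (pair_diff t x) (joint_diff H)).
congr ('d _ _ _); rewrite diff_pair//.
by rewrite /= diff_cst (diff_val (is_diff_def := is_diff_id x)).
Qed.

Lemma diff_local_flow_cont i j (t : R) (x v : 'rV[R]_3) : fo i j t x ->
  {for (t, x), continuous (fun z : R * 'rV[R]_3 => 'd (lf i j z.1) (z.2 : 'rV[R]_3) v)}.
Proof.
move=> H; have [_ _ _ _ /(_ i j)[_ /(_ (0, v) (t, x) H) c]] := psiY.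
have E : \forall z \near (t, x),
    'd (joint i j) z (0, v) = 'd (lf i j z.1) (z.2 : 'rV[R]_3) v.
  apply: filterS (near_flow_overlap H) => -[s y] /= Hsy.
  by rewrite diff_joint.
exact: near_eq_continuous E c.
Qed.

Lemma diff_local_flowD i j k s t x v : fo i j t x -> fo j k s (lf i j t x) ->
  'd (lf i k (s + t)) x v = 'd (lf j k s) (lf i j t x) ('d (lf i j t) x v).
Proof.
move=> H1 H2; have H3 : fo i k (s + t) x.
  by split; [case: H1|apply/(flow_overlapD _ _ H1)].
have D1 := local_flow_diff H1; have D2 := local_flow_diff H2.
transitivity ('d (lf j k s \o lf i j t) x v); last exact: (diff_compE v D1 D2).
apply: near_eq_diff.
- by apply: filterS (near_flow_overlap_x H1) => y Hy; rewrite /= local_flowD.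
- exact: local_flow_diff.
- exact: differentiable_comp D1 D2.
Qed.

Lemma local_flow_id i x : cod i x -> lf i i 0 x = x.
Proof. by move=> xi; rewrite local_flow0 /transition/= paramK. Qed.

Lemma diff_local_flow_id i x v : cod i x -> 'd (lf i i 0) x v = v.
Proof.
move=> xi; rewrite (@near_eq_diff _ _ _ _ id)//; first
  by rewrite (diff_val (is_diff_def := is_diff_id x)).
- have : \forall y \near x, cod i y
  by apply: open_nbhs_nbhs; split => //; exact: open_cod.
  by apply: filterS => y yi; rewrite local_flow_id.
- by apply: local_flow_diff; exact: flow_overlap_id.
Qed.

Lemma local_flow_derive i j t x : fo i j t x ->
  is_derive t 1 (fun s => lf i j s x) (Y j (lf i j t x)).
Proof. by move=> [_ H]; have [_ _ /(_ t _ _ H)] := psiY. Qed.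

(** Both sides are the velocity at [s = 0] of one curve, written as the time [t] map after time [s],
    and as the orbit at time [s + t]. *)
Lemma flow_invariant_field i j t x : fo i j t x ->
  'd (lf i j t) x (Y i x) = Y j (lf i j t x).
Proof.
move=> H; have xi : cod i x by case: H.
have H0 := flow_overlap_id xi.
have D0 := local_flow_derive H0; rewrite local_flow_id// in D0.
have D1 : is_derive (0 : R) 1 (lf i j t \o (fun s => lf i i s x))
    ('d (lf i j t) (lf i i 0 x) (Y i x)).
  apply: (is_derive_comp_diff D0); rewrite local_flow_id//.
  exact: local_flow_diff.
rewrite local_flow_id// in D1.
have D2 : is_derive (0 : R) 1 ((fun s => lf i j s x) \o (fun s => s + t))
    ('d (fun s => lf i j s x) (0 + t) 1).
  apply: (@is_derive_comp_diff _ _ _ (fun s : R => s + t)).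
    exact: is_derive_shift.
  rewrite add0r; apply/derivable1_diffP.
  by have [] := local_flow_derive H.
have E : \forall s \near (0 : R), (lf i j t \o (fun s => lf i i s x)) s =
    ((fun s => lf i j s x) \o (fun s => s + t)) s.
  have c : {for (0 : R), continuous (fun s : R => (s, x))}.
    exact: differentiable_continuous (pair_diff_l 0 x).
  have E0 : \forall s \near (0 : R), fo i i s x
    by exact: c _ (near_flow_overlap H0).
  apply: filterS E0 => s Hs.
  by rewrite /= local_flowD// addrC.
have := near_eq_is_derive E D1 => D3.
have := derive_val (is_derive := D3); rewrite (derive_val (is_derive := D2)) => <-.
rewrite add0r -deriveE; last first.
  by apply/derivable1_diffP; have [] := local_flow_derive H.
by rewrite (derive_val (is_derive := local_flow_derive H)).
Qed.

End Charts.

Lemma diff_coordE (R : realType) (W : normedModType R) (f : 'rV[R]_3 -> W) x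
    (w : 'rV[R]_3) :
  'd f x w = \sum_l w 0 l *: 'd f x (delta_mx 0 l).
Proof.
rewrite {1}[w]row_sum_delta linear_sum; apply: eq_bigr => l _.
exact: linearZ.
Qed.

(** Continuity of the differential is given for each fixed vector; expanding the vector in the
    standard basis makes it joint. *)
Lemma cvg_diff_mx (R : realType) (T : Type) (F : set_system T) (FF : Filter F) m n
    (f : 'rV[R]_3 -> 'M[R]_(m, n)) (y w : T -> 'rV[R]_3) (y0 w0 : 'rV[R]_3) :
  (forall v, {for y0, continuous (fun x => 'd f x v)}) ->
  y @ F --> y0 -> w @ F --> w0 -> 'd f (y t) (w t) @[t --> F] --> 'd f y0 w0.
Proof.
move=> fc yc wc; apply: cvg_mx => i j.
have E x u : ('d f x u) i j = \sum_l u 0 l * ('d f x (delta_mx 0 l)) i j.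
  by rewrite diff_coordE summxE; apply: eq_bigr => l _; rewrite mxE.
rewrite E.
have -> : (fun t => ('d f (y t) (w t)) i j) =
    fun t => \sum_l w t 0 l * ('d f (y t) (delta_mx 0 l)) i j.
  by apply/funext => t; exact: E.
apply: cvg_sum => l; apply: cvgM; first exact: cvg_mx_coord.
apply: cvg_mx_coord.
exact: (@cvg_comp _ _ _ y (fun x => 'd f x (delta_mx 0 l)) _ _ _ yc (fc _)).
Qed.

Lemma near_rectangle (R : realType) (x v : 'rV[R]_3) (P : R * 'rV[R]_3 -> Prop) :
  (\forall z \near ((0 : R), x), P z) ->
  exists2 r, 0 < r & forall t e : R, `|t| < r -> `|e| < r -> P (t, x + e *: v).
Proof.
move=> /nbhs_ballP[r /= r0 Hr].
(* This radius keeps both [t] and [e *: v] smaller than [r]. *)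
exists (r / (1 + `|v|)); first by rewrite divr_gt0// ltr_pwDl.
have v1 : 0 < 1 + `|v| by rewrite ltr_pwDl.
move=> t e; rewrite !ltr_pdivlMr// => tr er; apply: Hr; split => /=.
  rewrite /ball/= sub0r normrN (le_lt_trans _ tr)// ler_peMr//.
  by rewrite lerDl.
rewrite -ball_normE /ball_/= opprD addrA subrr sub0r normrN normrZ.
by rewrite (le_lt_trans _ er)// ler_wpM2l// lerDr.
Qed.

(** * Lie derivatives along the flow *)

Section Lie.
Context (R : realType) (M : closed_oriented_3manifold R).
Variables (Y : field M) (psi : R -> M -> M).
Hypotheses (Y1 : vector_field 1 Y) (psiY : flow_of Y psi).

Local Notation lf := (local_flow psi).
Local Notation fo := (flow_overlap psi).

Lemma field_diff i x : cod i x -> differentiable (Y i) x.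
Proof. by move=> xi; have [_ /(_ i)[/(_ x xi)]] := Y1. Qed.

Lemma field_diff_cont i x v : cod i x ->
  {for x, continuous (fun y => 'd (Y i) y v)}.
Proof. by move=> xi; have [_ /(_ i)[_ /(_ v x xi)]] := Y1. Qed.

Lemma is_derive_line (x v : 'rV[R]_3) (e : R) : is_derive e 1 (fun e => x + e *: v) v.
Proof.
have H : is_derive e 1 (fun e : R => e *: v) v.
  apply: DeriveDef.
    by apply: diff_derivable; exact: differentiableZl.
  rewrite deriveE; last exact: differentiableZl.
  by rewrite diffZl//= (diff_val (is_diff_def := is_diff_id e)) scale1r.
have := is_deriveD (is_derive_cst x e 1) H.
by rewrite add0r.
Qed.

(** The linearised equation at time 0. As the flow is only [C^1], it is obtained from
    [mixed_derivative] for the orbits of [x + e *: v]: their velocity is given by [Y], which can be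
    differentiated in [e]. *)
Lemma diff_local_flow_derive i x v k : cod i x ->
  is_derive (0 : R) 1 (fun t => ('d (lf i i t) x v) 0 k) (('d (Y i) x v) 0 k).
Proof.
move=> xi; have H0 := flow_overlap_id psiY xi.
have x0 : x + 0 *: v = x by rewrite scale0r addr0.
pose S (t e : R) := ('d (Y i) (lf i i t (x + e *: v))
  ('d (lf i i t) (x + e *: v) v)) 0 k.
have lid := local_flow_id psiY xi; have dlid := diff_local_flow_id psiY v xi.
have E1 : lf i i 0 (x + 0 *: v) = x by rewrite x0.
have E2 : 'd (lf i i 0) (x + 0 *: v) v = v
  by exact: etrans (f_equal (fun y : 'rV[R]_3 => 'd (lf i i 0) y v) x0) dlid.
have SE : S 0 0 = ('d (Y i) x v) 0 k.
  exact: (f_equal2 (fun y u : 'rV[R]_3 => ('d (Y i) y u) 0 k) E1 E2).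
apply: (@is_derive_eq _ _ _ _ _ _ _ _ _ SE).
have [r r0 Hr] := near_rectangle v (near_flow_overlap psiY H0).
apply: (@mixed_derivative R (fun t e => lf i i t (x + e *: v) 0 k)
  (fun t e => Y i (lf i i t (x + e *: v)) 0 k) S _ r r0).
- move=> t e tr er; apply: is_derive_mx.
  exact: (local_flow_derive psiY (Hr t e tr er)).
- move=> t e tr er; apply: is_derive_mx.
  have H := Hr t e tr er.
  have dlf := local_flow_diff psiY H.
  have dY := field_diff (cod_lf H).
  rewrite -(diff_compE _ dlf dY).
  apply: (is_derive_comp_diff (is_derive_line x v e)).
  exact: differentiable_comp dlf dY.
- move=> t tr; apply: is_derive_mx.
  have r00 : `|0 : R| < r by rewrite normr0.
  have D := is_derive_comp_diff (is_derive_line x v 0)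
    (local_flow_diff psiY (Hr t 0 tr r00)).
  apply: (is_derive_eq D).
  exact: (f_equal (fun y : 'rV[R]_3 => 'd (lf i i t) y v) x0).
- move=> eps eps0.
  have lfc : {for ((0 : R), x), continuous (fun z : R * 'rV[R]_3 => lf i i z.1 z.2)}.
    exact: differentiable_continuous (joint_diff psiY H0).
  have dlfc := diff_local_flow_cont (v := v) psiY H0.
  have Yc u : {for lf i i 0 x, continuous (fun y => 'd (Y i) y u)}.
    by apply: field_diff_cont; exact: cod_lf H0.
  have Sc := cvg_mx_coord (i := 0) (j := k) (cvg_diff_mx _ Yc lfc dlfc).
  have SE' : 'd (Y i) (lf i i 0 x) ('d (lf i i 0) x v) 0 k = S 0 0.
    rewrite SE.
    exact: (f_equal2 (fun y u : 'rV[R]_3 => ('d (Y i) y u) 0 k) lid dlid).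
  pose P (z : R * 'rV[R]_3) := is_true
      (`|('d (Y i) (lf i i 0 x) ('d (lf i i 0) x v)) 0 k -
       ('d (Y i) (lf i i z.1 z.2) ('d (lf i i z.1) (z.2 : 'rV[R]_3) v)) 0 k| <= eps).
  have HP : \forall z \near ((0 : R), x), P z.
    exact: ((cvgrPdist_le _ _).1 (Sc _) eps eps0).
  have [d d0 Hd] := near_rectangle v HP; exists d; first exact: d0.
  move=> t e td ed.
  have Hl l l' (y : R) : l = l' -> `|l - y| <= eps -> `|y - l'| <= eps.
    by move=> ->; rewrite distrC.
  exact: Hl _ _ (S t e) SE' (Hd t e td ed).
Qed.

(** The coordinate expression of the Lie derivative of [b] along [Y], evaluated on [v]. *)
Definition lie (b : cofield M) i x v :=
  ap ('d (b i) x (Y i x)) v + ap (b i x) ('d (Y i) x v).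

Lemma apE (b : 'cV[R]_3) (v : 'rV[R]_3) : ap b v = \sum_k v 0 k * b k 0.
Proof. by rewrite /ap mxE. Qed.

Lemma lie_derive (b : cofield M) i x v : one_form 1 b -> cod i x ->
  is_derive (0 : R) 1 (fun t => ap (b i (lf i i t x)) ('d (lf i i t) x v))
    (lie b i x v).
Proof.
move=> [_ /(_ i)[bd _]] xi; have H0 := flow_overlap_id psiY xi.
have Hb k : is_derive (0 : R) 1 (fun t => b i (lf i i t x) k 0)
    (('d (b i) x (Y i x)) k 0).
  apply: is_derive_mx.
  have := local_flow_derive psiY H0; rewrite (local_flow_id psiY)// => D0.
  have := is_derive_comp_diff (g := b i) D0.
  by rewrite (local_flow_id psiY)//; apply; exact: bd.
have Hv k := diff_local_flow_derive v k xi.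
have -> : (fun t => ap (b i (lf i i t x)) ('d (lf i i t) x v)) =
    \sum_k ((fun t => ('d (lf i i t) x v) 0 k) * (fun t => b i (lf i i t x) k 0)).
  by apply/funext => t; rewrite apE fct_sumE.
have e1 k : ('d (lf i i 0) x v) 0 k = v 0 k.
  exact: (f_equal (fun u : 'rV[R]_3 => u 0 k) (diff_local_flow_id psiY v xi)).
have e2 k : b i (lf i i 0 x) k 0 = b i x k 0.
  exact: (f_equal (fun y : 'rV[R]_3 => b i y k 0) (local_flow_id psiY xi)).
have D k : is_derive (0 : R) 1
    ((fun t => ('d (lf i i t) x v) 0 k) * (fun t => b i (lf i i t x) k 0))
    (v 0 k * ('d (b i) x (Y i x)) k 0 + ('d (Y i) x v) 0 k * b i x k 0).
  apply: (is_derive_eq (is_deriveM (Hv k) (Hb k))).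
  rewrite [RHS]/(_ + _) [('d (Y i) x v) 0 k * _]mulrC.
  exact: (f_equal2 (fun s u : R => s * ('d (b i) x (Y i x)) k 0 +
    u * ('d (Y i) x v) 0 k) (e1 k) (e2 k)).
apply: (is_derive_eq (is_derive_sum D)).
rewrite big_split /=; congr (_ + _); rewrite apE; exact: eq_bigr.
Qed.

End Lie.

(** * The flow in a coframe *)

Lemma unitmx_rowP (R : realType) (P X X' : 'M[R]_3) : P \in unitmx ->
  (forall v : 'rV_3, v *m P *m X = v *m P *m X') -> X = X'.
Proof.
move=> uP H; apply/row_matrixP => r; rewrite !rowE.
by have := H (delta_mx 0 r *m invmx P); rewrite mulmxKV.
Qed.

Section Coframe.
Context (R : realType) (M : closed_oriented_3manifold R).
Variables (Y : field M) (psi : R -> M -> M).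
Hypotheses (Y1 : vector_field 1 Y) (psiY : flow_of Y psi).
Variable a : 'I_3 -> cofield M.
Hypothesis a1 : forall k, one_form 1 (a k).

Local Notation lf := (local_flow psi).
Local Notation fo := (flow_overlap psi).

(* Sealed, since unification otherwise unfolds the differential and diverges. *)
Fact tmap_spec : {f : chart M -> chart M -> R -> 'rV[R]_3 -> 'rV[R]_3 -> 'rV[R]_3 |
  forall i j t x v, f i j t x v = 'd (lf i j t) x v}.
Proof. by exists (fun i j t x v => 'd (lf i j t) x v). Qed.

Definition tmap := sval tmap_spec.

Lemma tmapE i j t x v : tmap i j t x v = 'd (lf i j t) x v.
Proof. exact: (svalP tmap_spec). Qed.

Fact tmap_mx_spec : {J : chart M -> chart M -> R -> 'rV[R]_3 -> 'M[R]_3 |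
  forall i j t x v, v *m J i j t x = tmap i j t x v}.
Proof.
exists (fun i j t x => jacobian (lf i j t) x) => i j t x v.
rewrite tmapE; exact: mul_rV_lin1.
Qed.

Definition tmap_mx := sval tmap_mx_spec.

Lemma mul_tmap_mx i j t x v : v *m tmap_mx i j t x = tmap i j t x v.
Proof. exact: (svalP tmap_mx_spec). Qed.

Definition coframe i x : 'M[R]_3 := \matrix_(r, k) a k i x r 0.

Hypothesis unit_coframe : forall i x, cod i x -> coframe i x \in unitmx.

Lemma coframeE i x v k : (v *m coframe i x) 0 k = ap (a k i x) v.
Proof. by rewrite apE mxE; apply: eq_bigr => r _; rewrite mxE. Qed.

(** The flow at time 0 is the change of charts, under which the values of the forms on a tangent
    vector are preserved. *)
Lemma coframe_transition i j x v : fo i j 0 x ->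
  tmap i j 0 x v *m coframe j (lf i j 0 x) = v *m coframe i x.
Proof.
move=> H; apply/rowP => k; rewrite !coframeE.
have [/(_ i j x v) a1i _] := a1 k.
rewrite -a1i; last by rewrite -(flow_overlap0 psiY).
rewrite tmapE.
exact: (f_equal (fun f => ap (a k j (f x)) ('d f x v)) (local_flow0 psiY i j)).
Qed.

Lemma tmapD i j k s t x v : fo i j t x -> fo j k s (lf i j t x) ->
  tmap i k (s + t) x v = tmap j k s (lf i j t x) (tmap i j t x v).
Proof. move=> H1 H2; rewrite !tmapE; exact: (diff_local_flowD psiY v H1 H2). Qed.

Lemma tmap_id i x v : cod i x -> tmap i i 0 x v = v.
Proof. move=> H; rewrite tmapE; exact: (diff_local_flow_id psiY v H). Qed.

Definition chart_at (p : M) : chart M := sval (cid (dom_cover p)).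

Lemma chart_atP p : dom (chart_at p) p.
Proof. exact: svalP (cid (dom_cover p)). Qed.

(** The differential of the flow in the trivialisation given by the coframe. The charts are chosen
    point by point, without continuity; [frame_cocycleE] shows that the choice does not matter. *)
Definition frame_cocycle t p : 'M[R]_3 :=
  let i := chart_at p in let j := chart_at (psi t p) in let x := Defs.coord i p in
  invmx (coframe i x) *m tmap_mx i j t x *m coframe j (lf i j t x).

Local Notation B := frame_cocycle.

(** Arbitrary charts are compared with the chosen ones by inserting the flow at time 0, that is a
    change of charts, at both ends. *)
Lemma frame_cocycleE i j t x v : fo i j t x ->
  tmap i j t x v *m coframe j (lf i j t x) = v *m coframe i x *m B t (param i x).
Proof.
move=> H; have [xi pj] := H; set p := param i x.
have pi : dom i p by exact: param_dom.
rewrite /B; set i0 := chart_at p; set x0 := Defs.coord i0 p; set j0 := chart_at _.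
have p0 : dom i0 p by exact: chart_atP.
have x0c : cod i0 x0 by exact: coord_cod.
have px0 : param i0 x0 = p by exact: coordK.
have H0 : fo i i0 0 x by split => //; rewrite (flow0 psiY).
have lfx : lf i i0 0 x = x0 by rewrite /local_flow (flow0 psiY).
have H1 : fo i0 j0 t x0 by split => //; rewrite px0; exact: chart_atP.
have H1' : fo i0 j t x0 by split => //; rewrite px0.
have H2 : fo j0 j 0 (lf i0 j0 t x0).
  by apply/(flow_overlapD psiY _ _ H1); rewrite add0r px0.
have E0 := coframe_transition v H0; rewrite lfx in E0.
rewrite -E0; set w := tmap i i0 0 x v.
rewrite !mulmxA (mulmxK (unit_coframe x0c)) (mul_tmap_mx i0 j0 t x0 w).
rewrite -(coframe_transition _ H2).
have H0' : fo i0 j t (lf i i0 0 x) by rewrite lfx.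
have E1 := tmapD v H0 H0'; rewrite lfx addr0 -/w in E1.
have E2 := tmapD w H1 H2; rewrite add0r in E2.
rewrite E1 E2; congr (_ *m coframe j _).
have F1 := local_flowD psiY j t H0; rewrite lfx addr0 in F1.
have F2 := local_flowD psiY j 0 H1; rewrite add0r in F2.
by rewrite F2 -F1.
Qed.

Lemma frame_cocycle_chart i j t x : fo i j t x ->
  B t (param i x) =
  invmx (coframe i x) *m tmap_mx i j t x *m coframe j (lf i j t x).
Proof.
move=> H; have [xi _] := H; apply: (unitmx_rowP (unit_coframe xi)) => v.
rewrite -(frame_cocycleE v H) -(mul_tmap_mx i j t x v) !mulmxA.
by rewrite (mulmxK (unit_coframe xi)).
Qed.

Lemma frame_cocycle0 p : B 0 p = 1%:M.
Proof.
have pc := coord_cod (chart_atP p); have pK := coordK (chart_atP p).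
apply: (unitmx_rowP (unit_coframe pc)) => v; rewrite mulmx1.
have H0 := flow_overlap_id psiY pc.
have := frame_cocycleE v H0.
by rewrite pK (tmap_id v pc) (local_flow_id psiY pc).
Qed.

Lemma frame_cocycleD s t p : B (s + t) p = B t p *m B s (psi t p).
Proof.
set i := chart_at p; set j := chart_at (psi t p); set k := chart_at (psi (s + t) p).
have pd : dom i p by exact: chart_atP.
have pc := coord_cod pd; have pK := coordK pd.
apply: (unitmx_rowP (unit_coframe pc)) => v; rewrite mulmxA.
have H1 : fo i j t (Defs.coord i p) by split => //; rewrite pK; exact: chart_atP.
have H2 : fo j k s (lf i j t (Defs.coord i p)).
  by apply/(flow_overlapD psiY _ _ H1); rewrite pK; exact: chart_atP.
have H3 : fo i k (s + t) (Defs.coord i p)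
  by split => //; rewrite pK; exact: chart_atP.
have E3 := frame_cocycleE v H3; rewrite pK in E3.
have E1 := frame_cocycleE v H1; rewrite pK in E1.
have E2 := frame_cocycleE (tmap i j t (Defs.coord i p) v) H2.
rewrite (param_lf H1) pK in E2.
rewrite -E3 -E1 -E2 (tmapD v H1 H2).
by rewrite (local_flowD psiY _ _ H1).
Qed.

(** The differential of the flow carries [Y] to [Y], whose coordinates in the coframe are
    [(0, 0, m)]. *)
Lemma frame_cocycle_field t p m : 
  (forall i x, cod i x -> Y i x *m coframe i x = m (param i x) *: delta_mx 0 2%:R) ->
  m p *: (delta_mx 0 2%:R *m B t p) = m (psi t p) *: (delta_mx 0 2%:R : 'rV_3).
Proof.
move=> Ym; set i := chart_at p; set j := chart_at (psi t p).
have pd : dom i p by exact: chart_atP.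
have pc := coord_cod pd; have pK := coordK pd.
have H1 : fo i j t (Defs.coord i p) by split => //; rewrite pK; exact: chart_atP.
have E1 := frame_cocycleE (Y i (Defs.coord i p)) H1.
have E2 : tmap i j t (Defs.coord i p) (Y i (Defs.coord i p)) = Y j (lf i j t (Defs.coord i p)).
  rewrite tmapE; exact: (flow_invariant_field psiY H1).
rewrite E2 !Ym// in E1; last exact: cod_lf H1.
by rewrite (param_lf H1) pK in E1; rewrite E1 scalemxAl.
Qed.

End Coframe.

Section MatrixContinuity.
Context {R : realType} {T : topologicalType}.

Lemma continuous_mx m n (f : T -> 'M[R]_(m, n)) x :
  (forall i j, {for x, continuous (fun y => f y i j)}) -> {for x, continuous f}.
Proof. exact: (@cvg_mx R T (nbhs x) _ m n f (f x)). Qed.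

Lemma continuous_mx_coord m n (f : T -> 'M[R]_(m, n)) x i j :
  {for x, continuous f} -> {for x, continuous (fun y => f y i j)}.
Proof. exact: (@cvg_mx_coord R T (nbhs x) m n f (f x)). Qed.

Lemma continuous_mulmx m n p (f : T -> 'M[R]_(m, n)) (g : T -> 'M[R]_(n, p)) x :
  {for x, continuous f} -> {for x, continuous g} ->
  {for x, continuous (fun y => f y *m g y)}.
Proof. exact: (@cvg_mulmx R T (nbhs x) _ m n p f g (f x) (g x)). Qed.

Lemma continuous_invmx n (f : T -> 'M[R]_n) x : f x \in unitmx ->
  {for x, continuous f} -> {for x, continuous (fun y => invmx (f y))}.
Proof. exact: (@cvg_invmx R T (nbhs x) _ n f (f x)). Qed.

Lemma continuous_ap (b : T -> 'cV[R]_3) (v : T -> 'rV[R]_3) x :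
  {for x, continuous b} -> {for x, continuous v} ->
  {for x, continuous (fun y => ap (b y) (v y))}.
Proof. by move=> bc vc; apply: continuous_mx_coord; exact: continuous_mulmx. Qed.

End MatrixContinuity.

Section CoframeCalculus.
Context (R : realType) (M : closed_oriented_3manifold R).
Variables (Y : field M) (psi : R -> M -> M).
Hypotheses (Y1 : vector_field 1 Y) (psiY : flow_of Y psi).
Variable a : 'I_3 -> cofield M.
Hypothesis a1 : forall k, one_form 1 (a k).
Hypothesis unit_coframe : forall i x, cod i x -> coframe a i x \in unitmx.

Local Notation lf := (local_flow psi).
Local Notation fo := (flow_overlap psi).
Local Notation B := (frame_cocycle psi a).
Local Notation coframe := (coframe a).

Lemma near_cod i x : cod i x -> \forall y \near x, cod (c := M) i y.
Proof. by move=> xi; apply: open_nbhs_nbhs; split => //; exact: open_cod. Qed.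

Lemma near_dom i p : dom i p -> \forall q \near p, dom (c := M) i q.
Proof. by move=> pi; apply: open_nbhs_nbhs; split => //; exact: open_dom. Qed.

Lemma coframe_cont i x : cod i x -> {for x, continuous (coframe i)}.
Proof.
move=> xi; apply: continuous_mx => r k.
have -> : (fun y => coframe i y r k) = fun y => a k i y r 0.
  by apply/funext => y; rewrite mxE.
apply: continuous_mx_coord.
have [_ /(_ i)[/(_ x xi) ad _]] := a1 k.
exact: differentiable_continuous ad.
Qed.

Lemma tmap_mx_cont i j t x : fo i j t x ->
  {for x, continuous (tmap_mx psi i j t)}.
Proof.
move=> H; apply: continuous_mx => r k.
have E y : tmap_mx psi i j t y r k = ('d (lf i j t) y (delta_mx 0 r)) 0 k.
  by rewrite -tmapE -mul_tmap_mx -rowE mxE.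
have -> : (fun y => tmap_mx psi i j t y r k) =
    fun y => ('d (lf i j t) y (delta_mx 0 r)) 0 k by apply/funext.
apply: continuous_mx_coord.
apply: (@continuous_comp _ _ _ (fun y => (t, y))
  (fun z : R * 'rV[R]_3 => 'd (lf i j z.1) (z.2 : 'rV[R]_3) (delta_mx 0 r))).
  exact: differentiable_continuous (pair_diff t x).
exact: (diff_local_flow_cont psiY H).
Qed.

(** Near [p] the charts chosen for [p] and [psi t p] can be kept fixed, and then every factor is
    continuous. *)
Lemma frame_cocycle_cont t r k : continuous (fun p => B t p r k).
Proof.
move=> p; set i := chart_at p; set j := chart_at (psi t p).
have pd : dom i p by exact: chart_atP.
have pc := coord_cod pd; have pK := coordK pd.
have H : fo i j t (Defs.coord i p) by split => //; rewrite pK; exact: chart_atP.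
pose G x := invmx (coframe i x) *m tmap_mx psi i j t x *m coframe j (lf i j t x).
have GB : \forall q \near p, G (Defs.coord i q) = B t q.
  have cc : {for p, continuous (Defs.coord i)} by exact: continuous_coord.
  have N : \forall q \near p, fo i j t (Defs.coord i q).
    exact: cc _ (near_flow_overlap_x psiY H).
  apply: filterS2 N (near_dom pd) => q Hq qd.
  by rewrite /G -(frame_cocycle_chart psiY a1 unit_coframe Hq) coordK.
have Gc : {for p, continuous (G \o Defs.coord i)}.
  apply: continuous_comp; first exact: continuous_coord.
  apply: continuous_mulmx; first apply: continuous_mulmx.
  - by apply: continuous_invmx; [exact: unit_coframe|exact: coframe_cont].
  - exact: tmap_mx_cont.
  - apply: (@continuous_comp _ _ _ (lf i j t) (coframe j)).
      exact: differentiable_continuous (local_flow_diff psiY H).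
    exact: coframe_cont (cod_lf H).
have := near_eq_continuous GB Gc.
exact: continuous_mx_coord.
Qed.

(** The rows of the inverse coframe are the dual frame; the entries are the Lie derivatives of the
    forms along [Y], evaluated on it. *)
Definition generator p : 'M[R]_3 := \matrix_(r, k)
  (let i := chart_at p in let x := Defs.coord i p in
   lie Y (a k) i x (row r (invmx (coframe i x)))).

Lemma frame_cocycle_derive i x r k : cod i x ->
  is_derive (0 : R) 1 (fun t => B t (param i x) r k)
    (lie Y (a k) i x (row r (invmx (coframe i x)))).
Proof.
move=> xi; set v := row r _.
have H0 := flow_overlap_id psiY xi.
have E : \forall t \near (0 : R),
    ap (a k i (lf i i t x)) ('d (lf i i t) x v) = B t (param i x) r k.
  have c : {for (0 : R), continuous (fun s : R => (s, x))}.
    exact: differentiable_continuous (pair_diff_l 0 x).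
  have N : \forall t \near (0 : R), fo i i t x.
    exact: c _ (near_flow_overlap psiY H0).
  apply: filterS N => t Ht.
  rewrite -tmapE -coframeE (frame_cocycleE psiY a1 unit_coframe v Ht).
  by rewrite -row_mul (mulVmx (unit_coframe xi)) -row_mul mul1mx mxE.
exact: near_eq_is_derive E (lie_derive Y1 psiY v (a1 k) xi).
Qed.

(** In every chart the expression is the derivative at time 0 of the same entry of the cocycle. *)
Lemma generatorE i x r k : cod i x ->
  generator (param i x) r k = lie Y (a k) i x (row r (invmx (coframe i x))).
Proof.
move=> xi; set p := param i x.
have pd : dom (chart_at p) p by exact: chart_atP.
have pc := coord_cod pd; have pK := coordK pd.
have D1 := frame_cocycle_derive r k pc; rewrite pK in D1.
have D2 := frame_cocycle_derive r k xi.
rewrite mxE.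
exact: etrans (esym (derive_val (is_derive := D1))) (derive_val (is_derive := D2)).
Qed.

Lemma generator_derive p r k :
  is_derive (0 : R) 1 (fun t => B t p r k) (generator p r k).
Proof.
have pd : dom (chart_at p) p by exact: chart_atP.
have D1 := frame_cocycle_derive r k (coord_cod pd); rewrite (coordK pd) in D1.
by rewrite mxE.
Qed.

Lemma generator_cont r k : continuous (fun p => generator p r k).
Proof.
move=> p; set i := chart_at p.
have pd : dom i p by exact: chart_atP.
have pc := coord_cod pd.
pose G x := lie Y (a k) i x (row r (invmx (coframe i x))).
have GB : \forall q \near p, (G \o Defs.coord i) q = generator q r k.
  apply: filterS (near_dom pd) => q qd.
  by rewrite /G /= -generatorE ?coordK//; exact: coord_cod.
apply: (near_eq_continuous GB).
apply: continuous_comp; first exact: continuous_coord.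
have rc : {for Defs.coord i p, continuous (fun x => row r (invmx (coframe i x)))}.
  have ic : {for Defs.coord i p, continuous (fun x => invmx (coframe i x))}.
    by apply: continuous_invmx; [exact: unit_coframe|exact: coframe_cont].
  apply: continuous_mx => r' k'.
  have -> : (fun y => (row r (invmx (coframe i y))) r' k') =
      fun y => invmx (coframe i y) r k' by apply/funext => y; rewrite mxE.
  exact: continuous_mx_coord.
have [_ /(_ i)[ad adc]] := a1 k.
have Yc := differentiable_continuous (field_diff Y1 pc).
have idc : {for Defs.coord i p, continuous (@id 'rV[R]_3)} by exact: cvg_id.
apply: continuousD.
- apply: continuous_ap rc.
  apply: (cvg_diff_mx _ _ idc Yc) => v.
  exact: adc.
- apply: continuous_ap; first exact: differentiable_continuous (ad _ pc).
  apply: (cvg_diff_mx _ _ idc rc) => v.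
  exact: field_diff_cont.
Qed.

End CoframeCalculus.

(** * Contact forms *)

Lemma det3E (R : comNzRingType) (N : 'M[R]_3) :
  \det N = N 0 0 * (N 1 1 * N 2%:R 2%:R - N 1 2%:R * N 2%:R 1)
    - N 0 1 * (N 1 0 * N 2%:R 2%:R - N 1 2%:R * N 2%:R 0)
    + N 0 2%:R * (N 1 0 * N 2%:R 1 - N 1 1 * N 2%:R 0).
Proof.
(* Entries are indexed by natural numbers, so that the lifted ordinals of the cofactor expansions
   compute to numerals. *)
pose n (i j : nat) := N (inord i) (inord j).
have nE i j : N i j = n i j by rewrite /n !inord_val.
rewrite (expand_det_row _ ord0) !big_ord_recl big_ord0 /cofactor.
rewrite !(expand_det_row _ ord0) !big_ord_recl !big_ord0 /cofactor !det_mx11 !mxE.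
rewrite !nE /= /bump /= !addn0 !add0n -[(1 %% 3)%N]/1%N -[((1 + 1) %% 3)%N]/2%N.
by rewrite -[(1 + 1)%N]/2%N; ring.
Qed.

Section Contact.
Context (R : realType) (M : closed_oriented_3manifold R).

Lemma ext_dC (b : cofield M) i x u v : ext_d b i x u v = - ext_d b i x v u.
Proof. by rewrite /ext_d opprB. Qed.

Lemma ext_dZl (b : cofield M) i x (c : R) u v :
  ext_d b i x (c *: u) v = c * ext_d b i x u v.
Proof.
rewrite /ext_d /ap linearZ /= -scalemxAr -scalemxAl !mxE.
by rewrite mulrBr.
Qed.

(** Cartan's formula for a form that vanishes on [Y]: differentiating this vanishing in the
    direction [v] turns the term with the derivative of [Y] into one with the derivative of [b]. *)
Lemma lie_ext_d (Y : field M) (Y1 : vector_field 1 Y) (b : cofield M) i x v :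
  one_form 1 b -> cod i x -> (forall y, cod i y -> ap (b i y) (Y i y) = 0) ->
  lie Y b i x v = ext_d b i x (Y i x) v.
Proof.
move=> [_ /(_ i)[bd _]] xi bY.
have DY : is_derive x v (Y i) ('d (Y i) x v).
  have dY := field_diff Y1 xi.
  by split; [apply: diff_derivable; exact: dY|apply: deriveE; exact: dY].
have Db : is_derive x v (b i) ('d (b i) x v).
  have db := bd x xi.
  by split; [apply: diff_derivable; exact: db|apply: deriveE; exact: db].
have D k := is_deriveM (is_derive_mx 0 k DY) (is_derive_mx k 0 Db).
have E : \forall y \near x, (\sum_k ((fun y => Y i y 0 k) * (fun y => b i y k 0))) y = cst 0 y.
  apply: filterS (near_cod xi) => y yi.
  rewrite fct_sumE; transitivity (ap (b i y) (Y i y)); last exact: bY.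
  by rewrite apE.
have D0 := near_eq_is_derive E (is_derive_sum D).
have H := derive_val (is_derive := D0).
rewrite (derive_cst (0 : R)) big_split /= in H.
rewrite /lie /ext_d; congr (_ + _); apply/eqP; rewrite -addr_eq0; apply/eqP.
rewrite [RHS]H addrC !apE; congr (_ + _).
by apply: eq_bigr => k _; rewrite [RHS]mulrC.
Qed.

Lemma apZ (b : 'cV[R]_3) (c : R) v : ap b (c *: v) = c * ap b v.
Proof. by rewrite /ap -scalemxAl mxE. Qed.

Lemma apB (b : 'cV[R]_3) u v : ap b (u - v) = ap b u - ap b v.
Proof. by rewrite /ap mulmxBl !mxE. Qed.

Lemma ap_delta (b : 'cV[R]_3) k : ap b (delta_mx 0 k) = b k 0.
Proof. by rewrite /ap -rowE mxE. Qed.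

Lemma ext_dE (b : cofield M) i x u v :
  ext_d b i x u v = \sum_k \sum_l u 0 k * v 0 l *
    ext_d b i x (delta_mx 0 k) (delta_mx 0 l).
Proof.
have E u' v' : ap ('d (b i) x u') v' =
    \sum_k \sum_l u' 0 k * v' 0 l * ap ('d (b i) x (delta_mx 0 k)) (delta_mx 0 l).
  rewrite apE exchange_big; apply: eq_bigr => l _ /=.
  rewrite diff_coordE summxE mulr_sumr; apply: eq_bigr => k _.
  by rewrite mxE ap_delta; ring.
rewrite /ext_d (E u v) (E v u) [X in _ - X]exchange_big -sumrB.
apply: eq_bigr => k _; rewrite -sumrB; apply: eq_bigr => l _.
by rewrite mulrBr [v 0 l * _]mulrC.
Qed.

(** The left side is the 3-form [b /\ db] on the rows of [N]. *)
Lemma contact_volume_det (b : cofield M) i x (N : 'M[R]_3) :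
  ap (b i x) (row 0 N) * ext_d b i x (row 1 N) (row 2%:R N) +
  ap (b i x) (row 1 N) * ext_d b i x (row 2%:R N) (row 0 N) +
  ap (b i x) (row 2%:R N) * ext_d b i x (row 0 N) (row 1 N) =
  \det N * contact_volume b i x.
Proof.
rewrite /contact_volume !ap_delta.
rewrite !(ext_dE b i x (row _ _) (row _ _)) !apE.
set W := fun k l => ext_d b i x (delta_mx 0 k) (delta_mx 0 l).
have WC k l : W k l = - W l k by exact: ext_dC.
have W0 k : W k k = 0 by rewrite /W /ext_d subrr.
have S u v : \sum_k \sum_l row u N 0 k * row v N 0 l * ext_d b i x (delta_mx 0 k) (delta_mx 0 l)
   = (N u 0 * N v 1 - N u 1 * N v 0) * W 0 1 +
     (N u 1 * N v 2%:R - N u 2%:R * N v 1) * W 1 2%:R +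
     (N u 2%:R * N v 0 - N u 0 * N v 2%:R) * W 2%:R 0.
  rewrite !sum3E !mxE -/(W _ _) -!/(W _ _) !W0 (WC 1 0) (WC 2%:R 1) (WC 0 2%:R).
  ring.
rewrite !S !sum3E !mxE -!/(W _ _) det3E; ring.
Qed.

End Contact.

Section ContactGenerator.
Context (R : realType) (M : closed_oriented_3manifold R).
Variables (Y : field M) (psi : R -> M -> M).
Hypotheses (Y1 : vector_field 1 Y) (psiY : flow_of Y psi).
Variable a : 'I_3 -> cofield M.
Hypothesis a1 : forall k, one_form 1 (a k).
Hypothesis unit_coframe : forall i x, cod i x -> coframe a i x \in unitmx.
Hypotheses (a0Y : forall i x, cod i x -> ap (a 0 i x) (Y i x) = 0)
  (a1Y : forall i x, cod i x -> ap (a 1 i x) (Y i x) = 0).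
Hypothesis reeb : forall i x, cod i x ->
  ext_d (a 1) i x (Y i x) (row 1 (invmx (coframe a i x))) = 0.
Hypotheses (cv0 : forall i x, cod i x -> contact_volume (a 0) i x < 0)
  (cv1 : forall i x, cod i x -> 0 < contact_volume (a 1) i x).

(** As [Y] is killed by the first two forms, it is this multiple of the third vector of the dual
    frame. *)
Definition field_speed (p : M) : R :=
  ap (a 2%:R (chart_at p) (Defs.coord (chart_at p) p))
     (Y (chart_at p) (Defs.coord (chart_at p) p)).

Lemma field_speedE i x : cod i x ->
  ap (a 2%:R i x) (Y i x) = field_speed (param i x).
Proof.
move=> xi; set p := param i x; set j := chart_at p.
have pj : dom j p by exact: chart_atP.
have H : overlap i j x by split.
have [Yt _] := Y1; have [at_ _] := a1 2%:R.
have E : transition i j x = Defs.coord j p by [].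
by rewrite /field_speed -/j -E (Yt _ _ _ H) at_.
Qed.

Lemma coframe_field i x : cod i x ->
  Y i x *m coframe a i x = field_speed (param i x) *: delta_mx 0 2%:R.
Proof.
move=> xi; apply: row3P; rewrite !coframeE.
- by rewrite a0Y// !mxE mulr0.
- by rewrite a1Y// !mxE mulr0.
- by rewrite field_speedE// !mxE eqxx mulr1.
Qed.

Lemma fieldE i x : cod i x ->
  Y i x = field_speed (param i x) *: row 2%:R (invmx (coframe a i x)).
Proof.
move=> xi; rewrite -[LHS](mulmxK (unit_coframe xi)) coframe_field//.
by rewrite -scalemxAl -rowE.
Qed.

Lemma ap_dual_frame i x k r : cod i x ->
  ap (a k i x) (row r (invmx (coframe a i x))) = (r == k)%:R.
Proof.
by move=> xi; rewrite -coframeE -row_mul mulVmx ?unit_coframe// !mxE.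
Qed.

Lemma field_speed_cont : continuous field_speed.
Proof.
move=> p; set i := chart_at p.
have pd : dom i p by exact: chart_atP.
have E : \forall q \near p, ((fun x => ap (a 2%:R i x) (Y i x)) \o Defs.coord i) q = field_speed q.
  apply: filterS (near_dom pd) => q qd.
  by rewrite /= field_speedE ?coordK//; exact: coord_cod.
apply: (near_eq_continuous E).
apply: continuous_comp; first exact: continuous_coord.
have pc := coord_cod pd; have [_ /(_ i)[ad _]] := a1 2%:R.
apply: continuous_ap; first exact: differentiable_continuous (ad _ pc).
exact: differentiable_continuous (field_diff Y1 pc).
Qed.

Local Notation N i x := (invmx (coframe a i x)).

Lemma dual_det_neq0 i x : cod i x -> \det (N i x) != 0.
Proof. by move=> xi; rewrite -unitfE -unitmxE unitmx_inv unit_coframe. Qed.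

(** By Cartan's formula the entry is the exterior derivative of [a 1] on [Y], a multiple of the
    third dual vector, and the first one. On the dual frame [a 1] sees only the second vector, so
    this value is all that remains of the contact volume. *)
Lemma generator01 i x : cod i x -> generator Y a (param i x) 0 1 =
  field_speed (param i x) * (\det (N i x) * contact_volume (a 1) i x).
Proof.
move=> xi; rewrite (generatorE Y1 psiY a1 unit_coframe)// (lie_ext_d Y1)//;
  last exact: a1Y.
rewrite [Y i x]fieldE// ext_dZl -contact_volume_det !ap_dual_frame//=.
by rewrite mul0r mul1r add0r mul0r addr0.
Qed.

(** As for [generator01]; here the surviving term has the two dual vectors in the other order,
    whence the sign. *)
Lemma generator10 i x : cod i x -> generator Y a (param i x) 1 0 =
  - (field_speed (param i x) * (\det (N i x) * contact_volume (a 0) i x)).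
Proof.
move=> xi; rewrite (generatorE Y1 psiY a1 unit_coframe)// (lie_ext_d Y1)//;
  last exact: a0Y.
rewrite [Y i x]fieldE// ext_dZl -contact_volume_det !ap_dual_frame//=.
by rewrite !mul0r mul1r !addr0 ext_dC mulrN.
Qed.

(** The Reeb condition removes the [u]-term from the equation for [u]. *)
Lemma generator11 p : generator Y a p 1 1 = 0.
Proof.
have pd := chart_atP p; have pc := coord_cod pd; have pK := coordK pd.
rewrite -pK (generatorE Y1 psiY a1 unit_coframe)// (lie_ext_d Y1)//;
  last exact: a1Y.
exact: reeb.
Qed.

Hypothesis speed_neq0 : forall p, field_speed p != 0.

(** The product is minus a positive square times the product of the two contact volumes, which have
    opposite signs. *)
Lemma generator_hyperbolic p : 0 < generator Y a p 0 1 * generator Y a p 1 0.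
Proof.
have pd := chart_atP p; have pc := coord_cod pd; have pK := coordK pd.
set i := chart_at p in pd pc pK; set x := Defs.coord i p in pc pK.
have pos (m d u v : R) : m != 0 -> d != 0 -> u < 0 -> 0 < v ->
    0 < m * (d * v) * - (m * (d * u)).
  move=> m0 d0 u0 v0.
  have -> : m * (d * v) * - (m * (d * u)) = m ^+ 2 * (d ^+ 2 * (v * - u)) by ring.
  apply: mulr_gt0; first by rewrite exprn_even_gt0.
  apply: mulr_gt0; first by rewrite exprn_even_gt0.
  by rewrite mulr_gt0// oppr_gt0.
rewrite -pK (generator01 pc) (generator10 pc).
exact: pos (speed_neq0 _) (dual_det_neq0 pc) (cv0 pc) (cv1 pc).
Qed.

(** [eps = 1] gives the stable section, [eps = -1] the unstable one. *)
Lemma invariant_section (eps : R) : eps * eps = 1 ->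
  exists (e : M -> 'rV[R]_3) (lam : R),
  [/\ forall j, continuous (fun p => e p 0 j),
      0 < lam /\ forall p, e p 0 1 = 1,
      forall p, eps * generator Y a p 0 1 * e p 0 0 < 0 &
      forall t p, exists mu, [/\ mu != 0,
        e p *m frame_cocycle psi a (eps * t) p = mu *: e (psi (eps * t) p) &
        0 <= t -> `|mu| <= expR (- (lam * t))]].
Proof.
move=> eps2; have [_ _ _ psic _] := psiY.
apply: (@hyperbolic_section R M psi (frame_cocycle psi a) (generator Y a)
  field_speed).
- exact: closed3_compact.
- exact: flow0 psiY.
- exact: flowD psiY.
- exact: psic.
- exact: (frame_cocycle0 psiY a1 unit_coframe).
- exact: (frame_cocycleD psiY a1 unit_coframe).
- exact: (frame_cocycle_cont psiY a1 unit_coframe).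
- exact: (generator_derive Y1 psiY a1 unit_coframe).
- exact: (generator_cont Y1 psiY a1 unit_coframe).
- exact: field_speed_cont.
- exact: speed_neq0.
- move=> t p.
  have E := frame_cocycle_field psiY a1 unit_coframe t p coframe_field.
  have Ek k : field_speed p * frame_cocycle psi a t p 2%:R k =
      field_speed (psi t p) * (k == 2%:R)%:R.
    have := congr1 (fun v : 'rV[R]_3 => v 0 k) E.
    by rewrite -rowE !mxE eqxx.
  split.
  + by have := Ek 0; rewrite mulr0 => /eqP;
    rewrite mulf_eq0 (negPf (speed_neq0 p)) => /eqP.
  + by have := Ek 1; rewrite mulr0 => /eqP;
    rewrite mulf_eq0 (negPf (speed_neq0 p)) => /eqP.
  + by rewrite Ek eqxx mulr1.
- exact: generator11.
- exact: generator_hyperbolic.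
- exact: eps2.
Qed.

End ContactGenerator.

(** * Invariant line bundles *)

Section Bundle.
Context (R : realType) (M : closed_oriented_3manifold R).
Variables (Y : field M) (psi : R -> M -> M).
Hypotheses (psiY : flow_of Y psi).
Variable a : 'I_3 -> cofield M.
Hypothesis a1 : forall k, one_form 1 (a k).
Hypothesis unit_coframe : forall i x, cod i x -> coframe a i x \in unitmx.
Variables (e : M -> 'rV[R]_3) (eps lam : R).
Hypothesis eps2 : eps * eps = 1.
Hypothesis ec : forall j, continuous (fun p => e p 0 j).
Hypothesis e1 : forall p, e p 0 1 = 1.
Hypothesis einv : forall t p, exists mu, [/\ mu != 0,
  e p *m frame_cocycle psi a (eps * t) p = mu *: e (psi (eps * t) p) &
  0 <= t -> `|mu| <= expR (- (lam * t))].

Local Notation lf := (local_flow psi).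
Local Notation fo := (flow_overlap psi).

Definition bundle_vec i x : 'rV[R]_3 := e (param i x) *m invmx (coframe a i x).

Definition bundle : subspace_field M := fun i x => line (bundle_vec i x).

Lemma section_cont : continuous e.
Proof.
by move=> p; apply: continuous_mx => i j; rewrite (ord1 i); exact: ec.
Qed.

Lemma bundle_vec_neq0 i x : cod i x -> bundle_vec i x != 0.
Proof.
move=> xi; apply/eqP => h.
have : bundle_vec i x *m coframe a i x = 0 by rewrite h mul0mx.
rewrite /bundle_vec mulmxKV ?unit_coframe// => /rowP/(_ 1).
by rewrite e1 mxE => /eqP; rewrite oner_eq0.
Qed.

Lemma bundle_vec_cont i x : cod i x -> {for x, continuous (bundle_vec i)}.
Proof.
move=> xi; apply: continuous_mulmx.
  apply: (@continuous_comp _ _ _ (param i) e); first exact: continuous_param.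
  exact: section_cont.
apply: continuous_invmx; first exact: unit_coframe.
exact: (coframe_cont a1).
Qed.

Lemma tmap_bundle_vec i j t x mu : fo i j t x ->
  e (param i x) *m frame_cocycle psi a t (param i x) =
    mu *: e (psi t (param i x)) ->
  tmap psi i j t x (bundle_vec i x) = mu *: bundle_vec j (lf i j t x).
Proof.
move=> H E; have [xi _] := H; have uj := unit_coframe (cod_lf H).
rewrite -[LHS](mulmxK uj) (frame_cocycleE psiY a1 unit_coframe _ H).
rewrite /bundle_vec (mulmxKV (unit_coframe xi)) E -scalemxAl.
by rewrite (param_lf H).
Qed.

Lemma bundle_image i j t x mu : fo i j t x -> mu != 0 ->
  e (param i x) *m frame_cocycle psi a t (param i x) =
    mu *: e (psi t (param i x)) ->
  bundle j (lf i j t x) = 'd (lf i j t) x @` bundle i x.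
Proof.
move=> H mu0 E; have T := tmap_bundle_vec H E; rewrite tmapE in T.
have L (c : R) v : 'd (lf i j t) x (c *: v) = c *: 'd (lf i j t) x v
  by exact: linearZ.
apply/seteqP; split => [_ [c _ <-]|_ [_ [c _ <-] <-]].
  exists ((c / mu) *: bundle_vec i x); first by exists (c / mu).
  rewrite L T scalerA divfK//.
by exists (c * mu) => //; rewrite L T scalerA.
Qed.

Lemma bundle_invariant : flow_invariant psi bundle.
Proof.
move=> t i j x H.
(* [einv] at [eps * t] concerns the flow at time [eps * (eps * t) = t]. *)
have [mu [mu0 E _]] := einv (eps * t) (param i x).
by rewrite mulrA eps2 mul1r in E; exact: bundle_image H mu0 E.
Qed.

(** Compatibility with changes of charts is invariance under the flow at time 0. *)
Lemma bundle_line_field : line_field bundle.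
Proof.
split.
- move=> i j x H.
  have H0 : fo i j 0 x by rewrite (flow_overlap0 psiY).
  exact: (eq_ind _ (fun f => bundle j (f x) = 'd f x @` bundle i x)
    (bundle_invariant H0) _ (local_flow0 psiY i j)).
- move=> i x xi; exists (bundle_vec i).
  apply: filterS (near_cod xi) => y yi; split.
  + exact: bundle_vec_cont.
  + exact: bundle_vec_neq0.
  + exact: erefl.
Qed.

Variable g : bilinear_field M.
Hypothesis gR : riemannian_metric g.

Lemma metric_normZ i x (c : R) v :
  metric_norm g i x (c *: v) = `|c| * metric_norm g i x v.
Proof.
rewrite /metric_norm linearZ /= -scalemxAl -scalemxAr -scalemxAl scalerA mxE.
by rewrite -expr2 sqrtrM ?sqr_ge0// sqrtr_sqr.
Qed.

Definition bundle_norm p : R :=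
  let i := chart_at p in let x := Defs.coord i p in
  metric_norm g i x (bundle_vec i x).

Lemma bundle_normE i x : cod i x ->
  metric_norm g i x (bundle_vec i x) = bundle_norm (param i x).
Proof.
move=> xi; set p := param i x; set j := chart_at p.
have pj : dom j p by exact: chart_atP.
have H : overlap i j x by split.
have H0 : fo i j 0 x by rewrite (flow_overlap0 psiY).
have E : e (param i x) *m frame_cocycle psi a 0 (param i x) =
    1 *: e (psi 0 (param i x)).
  by rewrite (frame_cocycle0 psiY a1 unit_coframe) mulmx1 scale1r (flow0 psiY).
have T := tmap_bundle_vec H0 E; rewrite scale1r in T.
have lfE : lf i j 0 x = Defs.coord j p by rewrite /local_flow (flow0 psiY).
rewrite lfE in T.
have [gt _ _ _] := gR.
have := gt i j x (bundle_vec i x) (bundle_vec i x) H.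
have -> : 'd (transition i j) x (bundle_vec i x) = bundle_vec j (Defs.coord j p).
  rewrite -T tmapE.
  exact: (f_equal (fun f => 'd f x (bundle_vec i x)) (esym (local_flow0 psiY i j))).
rewrite -[transition i j x]/(Defs.coord j p) => E'.
by rewrite /bundle_norm /metric_norm -/j E'.
Qed.

Lemma bundle_norm_gt0 p : 0 < bundle_norm p.
Proof.
have pc := coord_cod (chart_atP p).
have [_ _ _ gpos] := gR.
by rewrite sqrtr_gt0; apply: gpos => //; exact: bundle_vec_neq0.
Qed.

Lemma bundle_norm_cont : continuous bundle_norm.
Proof.
move=> p; set i := chart_at p.
have pd : dom i p by exact: chart_atP.
have pc := coord_cod pd.
have E : \forall q \near p, ((fun x => metric_norm g i x (bundle_vec i x)) \o Defs.coord i) q = bundle_norm q.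
  apply: filterS (near_dom pd) => q qd.
  by rewrite /= bundle_normE ?coordK//; exact: coord_cod.
apply: (near_eq_continuous E).
apply: continuous_comp; first exact: continuous_coord.
have vc := bundle_vec_cont pc.
have [_ gs _ _] := gR.
have gc : {for Defs.coord i p, continuous (g i)} by exact: (gs i 0%N).
apply: (@continuous_comp _ _ _ (fun x => (bundle_vec i x *m g i x *m (bundle_vec i x)^T) 0 0) Num.sqrt).
  apply: continuous_mx_coord; apply: continuous_mulmx;
    first exact: continuous_mulmx.
  apply: continuous_mx => r k.
  have -> : (fun y => (bundle_vec i y)^T r k) = fun y => bundle_vec i y k r.
    by apply/funext => y; rewrite mxE.
  exact: continuous_mx_coord.
exact: sqrt_continuous.
Qed.

(** By compactness the metric norm of the spanning vector lies between the positive constants [c]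
    and [K], so the decay of [mu] carries over with the factor [K / c]. *)
Lemma bundle_contracted : exists2 A, 0 < A & contracted psi g bundle eps A lam.
Proof.
have Mc : compact [set: M] by exact: closed3_compact.
have [c c0 cn] := compact_pos_lb Mc bundle_norm_cont bundle_norm_gt0.
have [C Cn] := compact_norm_ub Mc bundle_norm_cont.
pose K := `|C| + 1.
have K0 : 0 < K by rewrite ltr_wpDl.
exists (K / c); first by rewrite divr_gt0.
move=> t i j x v t0 H [k _ <-]; have [xi _] := H.
have [mu [mu0 E /(_ t0) Hmu]] := einv t (param i x).
have T := tmap_bundle_vec H E; rewrite tmapE in T.
have L : 'd (lf i j (eps * t)) x (k *: bundle_vec i x) =
    k *: (mu *: bundle_vec j (lf i j (eps * t) x)) by rewrite -T; exact: linearZ.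
rewrite [X in metric_norm g j _ X]L !metric_normZ (bundle_normE xi) (bundle_normE (cod_lf H)).
set n1 := bundle_norm (param i x); set n2 := bundle_norm _.
have n1c : c <= n1 by exact: cn.
have n2K : n2 <= K.
  by rewrite (le_trans (ler_norm _))// (le_trans (Cn _))// (le_trans (ler_norm _))// lerDl.
have n20 : 0 < n2 by exact: bundle_norm_gt0.
set E0 := expR _ in Hmu *.
have E00 : 0 < E0 by exact: expR_gt0.
have step1 : `|mu| * n2 <= E0 * K by apply: ler_pM => //; exact: ltW.
have step2 : E0 * K <= E0 * (K / c * n1).
  by rewrite ler_pM2l// -mulrA ler_peMr ?(ltW K0)// mulrC ler_pdivlMr// mul1r.
rewrite (le_trans (ler_wpM2l (normr_ge0 k) (le_trans step1 step2)))//.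
rewrite le_eqVlt; apply/orP; left; apply/eqP; ring.
Qed.

End Bundle.

(** * Assembling the Anosov splitting *)

Lemma contracted_weaken (R : realType) (M : closed_oriented_3manifold R)
    (psi : R -> M -> M) g E sg (A A' lam lam' : R) :
  0 <= A -> A <= A' -> lam' <= lam ->
  contracted psi g E sg A lam -> contracted psi g E sg A' lam'.
Proof.
move=> A0 AA' ll H t i j x v t0 Hfo Ev.
apply: (le_trans (H t i j x v t0 Hfo Ev)).
apply: ler_wpM2r; first exact: sqrtr_ge0.
apply: ler_pM => //.
by rewrite ler_expR lerN2 ler_wpM2r.
Qed.

(** In coframe coordinates [y] is [(0, 0, m)], and the two sections have [u = 1] and distinct [w]:
    the coordinates [w] and [u] of [v] determine [l1] and [l2], then its [s] determines the
    coefficient of [y]. *)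
Lemma two_sections_span (R : realType) (M : closed_oriented_3manifold R)
    (a : 'I_3 -> cofield M) (es eu : M -> 'rV[R]_3) (y v : 'rV[R]_3) (m : R) i x :
  coframe a i x \in unitmx -> y *m coframe a i x = m *: delta_mx 0 2%:R -> m != 0 ->
  es (param i x) 0 1 = 1 -> eu (param i x) 0 1 = 1 ->
  es (param i x) 0 0 != eu (param i x) 0 0 ->
  exists c s u, [/\ bundle a es i x s, bundle a eu i x u & v = c *: y + s + u].
Proof.
move=> uP yE m0; set p := param i x => s1 u1; rewrite -subr_eq0 => su.
pose V := v *m coframe a i x.
pose l1 := (V 0 0 - eu p 0 0 * V 0 1) / (es p 0 0 - eu p 0 0).
pose l2 := V 0 1 - l1.
exists ((V 0 2%:R - l1 * es p 0 2%:R - l2 * eu p 0 2%:R) / m),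
  (l1 *: bundle_vec a es i x), (l2 *: bundle_vec a eu i x); split.
- by exists l1.
- by exists l2.
apply: (can_inj (mulmxK uP)); rewrite -/V !mulmxDl -!scalemxAl yE !mulmxKV// -/p.
have RE (c l l' : R) k :
    (c *: (m *: delta_mx 0 2%:R) + l *: es p + l' *: eu p) 0 k =
    c * (m * (k == 2%:R)%:R) + l * es p 0 k + l' * eu p 0 k by rewrite !mxE eqxx.
have l1E : l1 * (es p 0 0 - eu p 0 0) = V 0 0 - eu p 0 0 * V 0 1 by rewrite divfK.
apply: row3P; rewrite RE ?s1 ?u1.
- by rewrite !mulr0 add0r /l2; lra.
- by rewrite !mulr0 add0r !mulr1 /l2; lra.
- by rewrite eqxx mulr1 divfK//; lra.
Qed.

(** [X] lies in [xi_m] and [b] is 1 on it, so subtracting a multiple of [X] brings any vector into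
    the kernel of [b]. *)
Lemma bi_contact_reeb (R : realType) (M : closed_oriented_3manifold R)
    (X : field M) (xi_m xi_p eta_p : subspace_field M) (b : cofield M) :
  bi_contact xi_m xi_p -> spans_intersection X xi_m xi_p ->
  positive_contact_form b -> is_kernel eta_p b -> reeb_field X b ->
  bi_contact xi_m eta_p.
Proof.
move=> [cm _ _] Xs bp bk Xb; split => //; first by exists b.
move=> i x xi v; have [X0 XE] := Xs i x xi; have [bX _] := Xb i x xi.
have [al _ alk] := cm.
have XX : (xi_m i x `&` xi_p i x) (X i x) by rewrite XE; exists 1; rewrite ?scale1r.
exists (ap (b i x) v *: X i x), (v - ap (b i x) v *: X i x); split.
- have [Xm _] := XX; move: Xm; rewrite alk//= => Xm.
  by rewrite apZ Xm mulr0.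
- by rewrite bk//= apB apZ bX mulr1 subrr.
- by rewrite addrC subrK.
Qed.

Theorem proposition1p1 (R : realType) (M : closed_oriented_3manifold R)
    (X : field M) (phi : R -> M -> M) (xi_m xi_p eta_p : subspace_field M)
    (X_C1 : vector_field 1 X) (phi_flow : flow_of X phi)
    (xi_bicontact : bi_contact xi_m xi_p)
    (X_spans : spans_intersection X xi_m xi_p)
    (phi_contact_anosov : contact_anosov X phi eta_p) :
  bi_contact xi_m eta_p /\
  forall (Y : field M) (psi : R -> M -> M),
    vector_field 1 Y -> flow_of Y psi -> spans_intersection Y xi_m eta_p ->
    anosov Y psi.
Proof.
have [[g [_ [_ [_ [_ [[gR _ _ _ _] _ _ _ _]]]]]] [b [bp bk Xb]]] :=
  phi_contact_anosov.
split; first exact: (bi_contact_reeb xi_bicontact X_spans bp bk Xb).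
move=> Y psi Y1 psiY Ys.
have [[al alc alk] [be bec bek] _] := xi_bicontact.
(* This order makes [w], [u], [s] the values of [al], [b], [be]. *)
pose a (k : 'I_3) : cofield M := if k == 0 then al else if k == 1 then b else be.
have a1 k : one_form 1 (a k).
  by move: k; apply: ord3P; [case: alc|case: bp|case: bec].
have Xin i x : cod i x -> ap (al i x) (X i x) = 0 /\ ap (be i x) (X i x) = 0.
  move=> xi; have [_ XE] := X_spans i x xi.
  have : (xi_m i x `&` xi_p i x) (X i x) by rewrite XE; exists 1; rewrite ?scale1r.
  by rewrite alk// bek.
have Yin i x : cod i x -> ap (al i x) (Y i x) = 0 /\ ap (b i x) (Y i x) = 0.
  move=> xi; have [_ YE] := Ys i x xi.
  have : (xi_m i x `&` eta_p i x) (Y i x) by rewrite YE; exists 1; rewrite ?scale1r.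
  by rewrite alk// bk.
have kerX i x v : cod i x -> ap (al i x) v = 0 -> ap (be i x) v = 0 ->
    v = ap (b i x) v *: X i x.
  move=> xi v1 v2; have [_ XE] := X_spans i x xi; have [bX _] := Xb i x xi.
  have : (xi_m i x `&` xi_p i x) v by rewrite alk// bek.
  rewrite XE => -[c _ <-].
  by rewrite apZ bX mulr1.
have unit_a i x : cod i x -> coframe a i x \in unitmx.
  move=> xi; rewrite -row_free_unit; apply: inj_row_free => v v0.
  have va k : ap (a k i x) v = 0 by rewrite -coframeE v0 mxE.
  by rewrite (kerX i x v xi (va 0) (va 2%:R)) (va 1) scale0r.
have a0Y i x : cod i x -> ap (a 0 i x) (Y i x) = 0 by move=> /Yin[].
have a1Y i x : cod i x -> ap (a 1 i x) (Y i x) = 0 by move=> /Yin[].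
(* If [be] vanished on [Y], all three forms would, and [Y] would be 0. *)
have speed p : field_speed Y a p != 0.
  have pc := coord_cod (chart_atP p); apply/eqP => h.
  have [Y0 _] := Ys _ _ pc; move/eqP: Y0; apply.
  by rewrite (kerX _ _ _ pc (a0Y _ _ pc) h) (a1Y _ _ pc) scale0r.
have reeb i x : cod i x ->
    ext_d (a 1) i x (Y i x) (row 1 (invmx (coframe a i x))) = 0.
  move=> xi; have [_ dX] := Xb i x xi.
  (* The second dual vector is [X] itself: [al] and [be] kill it, and [b] is 1 on it. *)
  have ad k := ap_dual_frame unit_a k 1 xi.
  rewrite (kerX i x _ xi (ad 0) (ad 2%:R)) (ad 1) scale1r.
  by rewrite ext_dC dX oppr0.
have cv0 i x : cod i x -> contact_volume (a 0) i x < 0 by have [_] := alc; exact.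
have cv1 i x : cod i x -> 0 < contact_volume (a 1) i x by have [_] := bp; exact.
have e1 : (1 : R) * 1 = 1 by rewrite mulr1.
have e2 : (-1 : R) * -1 = 1 by rewrite mulrNN mulr1.
have [es [ls [esc [ls0 es1] es0 esinv]]] :=
  invariant_section Y1 psiY a1 unit_a a0Y a1Y reeb cv0 cv1 speed e1.
have [eu [lu [euc [lu0 eu1] eu0 euinv]]] :=
  invariant_section Y1 psiY a1 unit_a a0Y a1Y reeb cv0 cv1 speed e2.
have [As As0 Hs] := bundle_contracted psiY a1 unit_a esc es1 esinv gR.
have [Au Au0 Hu] := bundle_contracted psiY a1 unit_a euc eu1 euinv gR.
exists g, (bundle a es), (bundle a eu), (As + Au), (Num.min ls lu); split.
- split=> //.
  + exact: (bundle_line_field psiY a1 unit_a e1 esc es1 esinv).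
  + exact: (bundle_line_field psiY a1 unit_a e2 euc eu1 euinv).
  + exact: addr_gt0.
  + by rewrite lt_min ls0.
- move=> i x xi v.
  apply: (two_sections_span v (unit_a _ _ xi) (coframe_field Y1 a1 a0Y a1Y xi) (speed _)
    (es1 _) (eu1 _)).
  (* The [w]-coordinates of the two sections have opposite signs, so they cannot agree. *)
  apply/eqP => h; have := es0 (param i x); have := eu0 (param i x).
  by rewrite -h mul1r mulN1r mulNr oppr_lt0 => /lt_trans H /H; rewrite ltxx.
- exact: (bundle_invariant psiY a1 unit_a e1 esinv).
- exact: (bundle_invariant psiY a1 unit_a e2 euinv).
- split.
  + apply: contracted_weaken Hs; first exact: ltW.
      by rewrite lerDl ltW.
    by rewrite ge_min lexx.
  + apply: contracted_weaken Hu; first exact: ltW.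
      by rewrite lerDr ltW.
    by rewrite ge_min lexx orbT.
Qed.
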